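(* Let $V$ be a $\Bbbk$-vector space and let $\mathsf{Leib}(V)$ be the free Leibniz algebra on $V$. Then $$H_*(\mathsf{Lie}(s\,\mathsf{Leib}(V)), d_{\mathrm{Leib}}) \cong \begin{cases} \mathsf{Lie}(V) & * = 1\\ 0 & \text{otherwise,}\end{cases}$$ where $\mathsf{Lie}(V)$ is the free Lie algebra on $V$.
   Context: $\Bbbk$ is a field of characteristic zero. Graded vector spaces are homologically $\mathbb{Z}$-graded, with Koszul signs. A (right) Leibniz algebra is a $\Bbbk$-vector space $\mathfrak{g}$ (in degree $0$) with a bilinear product satisfying $x(yz) = (xy)z - (xz)y$; $\mathsf{Leib}(V)$ is the free such algebra on $V$. For a vector space $U$, $sU$ denotes $U$ placed in homological degree $1$. The Leibniz complex of $\mathfrak{g}$ is the tensor algebra $T(s\mathfrak{g})$ with differential $$d_{\mathrm{Leib}}(sx_1 \otimes \ldots \otimes sx_n) = \sum_{1 \le i<j\le n} (-1)^{j+1}\, sx_1 \otimes \ldots \otimes s(x_ix_j) \otimes \ldots \otimes \widehat{sx_j} \otimes \ldots \otimes sx_n .$$ $\mathsf{Lie}(s\mathfrak{g})$ is the free graded Lie algebra on $s\mathfrak{g}$, identified with the Lie subalgebra of $T(s\mathfrak{g})$ generated by $s\mathfrak{g}$ under the graded commutator $[X,Y] = X\otimes Y - (-1)^{|X||Y|} Y\otimes X$. It is stable under $d_{\mathrm{Leib}}$; $(\mathsf{Lie}(s\mathfrak{g}), d_{\mathrm{Leib}})$ is called the Pirashvili complex. Elements of $\mathsf{Lie}(s\mathfrak{g})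 \cap (s\mathfrak{g})^{\otimes n}$ have homological degree $n$. *)

(* Defs.v *)
From HB Require Import structures.
From mathcomp Require Import all_boot all_order all_algebra.
From mathcomp Require Import finmap.
From mathcomp.multinomials Require Import monalg.
From mathcomp.classical Require Import boolp.

Set Implicit Arguments.
Unset Strict Implicit.
Unset Printing Implicit Defensive.

Import GRing.Theory.
Local Open Scope ring_scope.
Local Open Scope quotient_scope.

(* Subspaces are Prop-valued; boolp turns membership into a boolean, so that
   the library's subtypes and quotients apply to them. *)

Record subspace (k : fieldType) (M : lmodType k) := Subspace {
  subspace_mem :> M -> Prop;
  subspace0 : subspace_mem 0;
  subspace_lin : forall a x y,
    subspace_mem x -> subspace_mem y -> subspace_mem (a *: x + y)
}.

Section Subspace.
Variables (k : fieldType) (M : lmodType k) (N : subspace M).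

Definition subspace_pred : pred M := fun x => `[< N x >].

Lemma subspace_predP x : reflect (N x) (x \in subspace_pred).
Proof. exact: asboolP. Qed.

Fact subspace_pred_closed : subsemimod_closed subspace_pred.
Proof.
apply: GRing.submod_closed_semi; split; first exact/subspace_predP/subspace0.
move=> a x y /subspace_predP Nx /subspace_predP Ny.
exact/subspace_predP/subspace_lin.
Qed.

HB.instance Definition _ :=
  GRing.isSubmodClosed.Build k M subspace_pred subspace_pred_closed.

Definition subspace_type := {x : M | x \in subspace_pred}.

HB.instance Definition _ := SubChoice.on subspace_type.
HB.instance Definition _ :=
  GRing.SubChoice_isSubLmodule.Build k M _ subspace_type subspace_pred_closed.

Definition lquot := Quotient.quot (GRing.ZmodClosed.clone M subspace_pred _).

HB.instance Definition _ := GRing.Zmodule.on lquot.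

End Subspace.

(* Locked, as are the other basic operations below, to keep unification from
   comparing representatives. *)
HB.lock Definition lpi (k : fieldType) (M : lmodType k) (N : subspace M)
  (x : M) : lquot N := \pi_(lquot N) x.

HB.lock Definition lquot_scale (k : fieldType) (M : lmodType k) (N : subspace M)
  (a : k) (x : lquot N) : lquot N := lpi N (a *: repr x).

Section LquotTheory.
Variables (k : fieldType) (M : lmodType k) (N : subspace M).
Local Notation lquot := (lquot N).
Local Notation lpi := (@lpi k M N).
Local Notation lquot_scale := (@lquot_scale k M N).

Lemma lpi_eq x y : lpi x = lpi y <-> N (x - y).
Proof.
rewrite lpi.unlock; split=> [/eqP|Nxy].
  by rewrite -Quotient.idealrBE => /subspace_predP.
by apply/eqP; rewrite -Quotient.idealrBE; apply/subspace_predP.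
Qed.

Lemma lpi_repr (x : lquot) : lpi (repr x) = x.
Proof. by rewrite lpi.unlock reprK. Qed.

Lemma lpi_surj (x : lquot) : exists y, x = lpi y.
Proof. by exists (repr x); rewrite lpi_repr. Qed.

Lemma lpiD x y : lpi (x + y) = lpi x + lpi y.
Proof. by rewrite lpi.unlock !piE. Qed.

Lemma lpi0 : lpi 0 = 0.
Proof. by rewrite lpi.unlock !piE. Qed.

Lemma lquot_scaleE a x : lquot_scale a (lpi x) = lpi (a *: x).
Proof.
rewrite lquot_scale.unlock; apply/lpi_eq; rewrite -scalerBr -[_ *: _]addr0.
apply: subspace_lin; last exact: subspace0.
by apply/lpi_eq; rewrite lpi_repr.
Qed.

Fact lquot_scaleA a b v :
  lquot_scale a (lquot_scale b v) = lquot_scale (a * b) v.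
Proof. by have [x ->] := lpi_surj v; rewrite !lquot_scaleE scalerA. Qed.

Fact lquot_scale1 : left_id 1 lquot_scale.
Proof. by move=> v; have [x ->] := lpi_surj v; rewrite lquot_scaleE scale1r. Qed.

Fact lquot_scaleDr : right_distributive lquot_scale +%R.
Proof.
move=> a u v; have [x ->] := lpi_surj u; have [y ->] := lpi_surj v.
by rewrite -lpiD !lquot_scaleE scalerDr lpiD.
Qed.

Fact lquot_scaleDl v : {morph lquot_scale^~ v : a b / a + b}.
Proof.
by move=> a b; have [x ->] := lpi_surj v; rewrite !lquot_scaleE scalerDl lpiD.
Qed.

HB.instance Definition _ := GRing.Zmodule_isLmodule.Build k lquot
  lquot_scaleA lquot_scale1 lquot_scaleDr lquot_scaleDl.

Fact lpi_is_linear : linear lpi.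
Proof. by move=> a x y; rewrite lpiD -lquot_scaleE. Qed.

HB.instance Definition _ := GRing.isLinear.Build k M lquot _ lpi lpi_is_linear.

Definition lquot_lift (P : lmodType k) (f : {linear M -> P})
  (_ : forall x, N x -> f x = 0) (x : lquot) : P := f (repr x).

Section Lift.
Variables (P : lmodType k) (f : {linear M -> P}).
Variable f0 : forall x, N x -> f x = 0.

Lemma lquot_liftE x : lquot_lift f0 (lpi x) = f x.
Proof.
apply/eqP; rewrite -subr_eq0 -linearB; apply/eqP/f0/lpi_eq.
by rewrite lpi_repr.
Qed.

Fact lquot_lift_is_linear : linear (lquot_lift f0).
Proof.
move=> a u v; have [x ->] := lpi_surj u; have [y ->] := lpi_surj v.
by rewrite -linearP !lquot_liftE linearP.
Qed.

HB.instance Definition _ :=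
  GRing.isLinear.Build k lquot P _ (lquot_lift f0) lquot_lift_is_linear.
End Lift.

End LquotTheory.

Inductive span (k : fieldType) (M : lmodType k) (S : M -> Prop) : M -> Prop :=
| span_zero : span S 0
| span_cons a x y : S x -> span S y -> span S (a *: x + y).

HB.lock Definition lin_ext (k : fieldType) (X : choiceType) (P : lmodType k)
  (f : X -> P) (g : {malg k[X]}) : P := \sum_(x <- msupp g) g@_x *: f x.

Section LinExt.
Variables (k : fieldType) (X : choiceType) (P : lmodType k) (f : X -> P).
Local Notation lin_ext := (@lin_ext k X P f).

Lemma lin_extEw (d : {fset X}) g : (msupp g `<=` d)%fset ->
  lin_ext g = \sum_(x <- d) g@_x *: f x.
Proof.
move=> le_gd; rewrite lin_ext.unlock (big_fset_incl _ le_gd) //= =>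
  x _ /mcoeff_outdom->.
by rewrite scale0r.
Qed.

Fact lin_ext_is_linear : linear lin_ext.
Proof.
move=> a g h; pose d := (msupp g `|` msupp h `|` msupp (a *: g + h))%fset.
rewrite (@lin_extEw d (a *: g + h)) ?fsubsetUr //.
rewrite (@lin_extEw d g) /d; last by rewrite -fsetUA fsubsetUl.
rewrite (@lin_extEw d h) /d; last by rewrite fsetUAC fsubsetUr.
rewrite scaler_sumr -big_split /=; apply: eq_bigr => x _.
by rewrite mcoeffD mcoeffZ scalerDl scalerA.
Qed.

HB.instance Definition _ :=
  GRing.isLinear.Build k {malg k[X]} P _ lin_ext lin_ext_is_linear.

Lemma lin_extU x : lin_ext << x >> = f x.
Proof. by rewrite lin_ext.unlock msuppU oner_eq0 big_seq_fset1 mcoeffUU scale1r. Qed.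
End LinExt.

Lemma malg_ind_lin (k : fieldType) (X : choiceType) (A : {malg k[X]} -> Prop) :
  A 0 -> (forall a x g, A g -> A (a *: << x >> + g)) -> forall g, A g.
Proof.
move=> A0 Alin g; rewrite [g]monalgE.
elim/big_rec: _ => // x h _ Ah.
have -> : << g@_x *g x >> = g@_x *: << x >> :> {malg k[X]}.
  by apply/malgP=> y; rewrite mcoeffZ !mcoeffU mulrnAr mulr1.
exact: Alin.
Qed.

(* Vector spaces with a bilinear product subject to no identity. *)
HB.mixin Record isNAAlgebra (k : fieldType) A of GRing.Lmodule k A := {
  namul : A -> A -> A;
  namul_linl : forall z, linear (namul^~ z);
  namul_linr : forall z, linear (namul z)
}.

#[short(type="naAlgType")]
HB.structure Definition NAAlgebra (k : fieldType) :=
  {A of isNAAlgebra k A & GRing.Lmodule k A}.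

Notation "x ** y" := (namul x y)
  (at level 40, left associativity) : ring_scope.

HB.mixin Record isLeibniz (k : fieldType) A of NAAlgebra k A := {
  right_leibniz : forall x y z : A, x ** (y ** z) = (x ** y) ** z - (x ** z) ** y
}.

#[short(type="leibnizType")]
HB.structure Definition Leibniz (k : fieldType) :=
  {A of isLeibniz k A & NAAlgebra k A}.

HB.mixin Record isLie (k : fieldType) A of NAAlgebra k A := {
  lie_alt : forall x : A, x ** x = 0;
  lie_jacobi : forall x y z : A,
    x ** (y ** z) + y ** (z ** x) + z ** (x ** y) = 0
}.

#[short(type="lieType")]
HB.structure Definition Lie (k : fieldType) :=
  {A of isLie k A & NAAlgebra k A}.

Section NATheory.
Variables (k : fieldType) (A : naAlgType k).
HB.instance Definition _ (z : A) :=
  GRing.isLinear.Build k A A _ (@namul k A z) (namul_linr z).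

Lemma namul0l (z : A) : 0 ** z = 0.
Proof.
by have := namul_linl z (-1) 0 0; rewrite !scaleN1r !addNr.
Qed.

Lemma namul0r (z : A) : z ** 0 = 0.
Proof. exact: linear0. Qed.
End NATheory.

(* The bilinear extension of op to the vector space with basis X. *)
HB.lock Definition malg_op (k : fieldType) (X : choiceType) (op : X -> X -> X)
  (g h : {malg k[X]}) : {malg k[X]} :=
  lin_ext (fun x => lin_ext (fun y => << op x y >> : {malg k[X]}) h) g.

Section MalgOp.
Variables (k : fieldType) (X : choiceType) (op : X -> X -> X).
Local Notation F := {malg k[X]}.
Local Notation malg_op := (@malg_op k X op).

Fact malg_op_linl h : linear (malg_op^~ h).
Proof. by move=> a x y; rewrite malg_op.unlock linearP. Qed.

Fact malg_op_linr g : linear (malg_op g).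
Proof.
move=> a h h'; rewrite malg_op.unlock; elim/malg_ind_lin: g => [|b x g IH].
  by rewrite !linear0 addr0.
rewrite !linearP /= !lin_extU IH linearP !scalerDr !scalerA [b * a]mulrC.
by rewrite addrACA.
Qed.

Lemma malg_opU x y : malg_op << x >> << y >> = << op x y >>.
Proof. by rewrite malg_op.unlock !lin_extU. Qed.

Lemma malg_op0l h : malg_op 0 h = 0.
Proof. by rewrite malg_op.unlock linear0. Qed.

Lemma malg_op0r g : malg_op g 0 = 0.
Proof. by have := malg_op_linr g (-1) 0 0; rewrite !scaleN1r !addNr. Qed.

End MalgOp.

Section Ideal.
Variables (k : fieldType) (X : choiceType) (op : X -> X -> X).
Variable rel : {malg k[X]} -> Prop.
Local Notation F := {malg k[X]}.
Local Notation malg_op := (@malg_op k X op).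

(* The smallest two-sided ideal containing rel. *)
Inductive ideal_gen : F -> Prop :=
| ideal_rel r of rel r : ideal_gen r
| ideal_zero : ideal_gen 0
| ideal_lin a x y of ideal_gen x & ideal_gen y : ideal_gen (a *: x + y)
| ideal_mull x y of ideal_gen y : ideal_gen (malg_op x y)
| ideal_mulr x y of ideal_gen x : ideal_gen (malg_op x y).

Definition ideal : subspace F := Subspace ideal_zero ideal_lin.

Definition presented := lquot ideal.

HB.instance Definition _ := GRing.Lmodule.on presented.

Definition pword (x : X) : presented := lpi ideal << x >>.

End Ideal.

HB.lock Definition pres_mul (k : fieldType) (X : choiceType) (op : X -> X -> X)
  (rel : {malg k[X]} -> Prop) (u v : presented op rel) : presented op rel :=
  lpi (ideal op rel) (malg_op op (repr u) (repr v)).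

Section Presented.
Variables (k : fieldType) (X : choiceType) (op : X -> X -> X).
Variable rel : {malg k[X]} -> Prop.
Local Notation F := {malg k[X]}.
Local Notation malg_op := (@malg_op k X op).
Local Notation ideal := (@ideal k X op rel).
Local Notation presented := (@presented k X op rel).
Local Notation pword := (@pword k X op rel).
Local Notation pres_mul := (@pres_mul k X op rel).

Lemma pres_mulE g h : pres_mul (lpi ideal g) (lpi ideal h) = lpi ideal (malg_op g h).
Proof.
rewrite pres_mul.unlock; apply/lpi_eq; set g' := repr _; set h' := repr _.
have Ig : ideal (g' - g) by apply/lpi_eq; rewrite lpi_repr.
have Ih : ideal (h' - h) by apply/lpi_eq; rewrite lpi_repr.
have -> : malg_op g' h' - malg_op g h
        = 1 *: malg_op (g' - g) h' + malg_op g (h' - h).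
  have -> : g' - g = -1 *: g + g' by rewrite scaleN1r addrC.
  have -> : h' - h = -1 *: h + h' by rewrite scaleN1r addrC.
  rewrite malg_op_linl malg_op_linr !scaleN1r scale1r.
  by rewrite [RHS]addrC addrA addrK addrC.
by apply: ideal_lin; [apply: ideal_mulr | apply: ideal_mull].
Qed.

Fact pres_mul_linl w : linear (pres_mul^~ w).
Proof.
move=> a u v; have [x ->] := lpi_surj u; have [y ->] := lpi_surj v.
have [z ->] := lpi_surj w.
by rewrite -linearP !pres_mulE malg_op_linl linearP.
Qed.

Fact pres_mul_linr w : linear (pres_mul w).
Proof.
move=> a u v; have [x ->] := lpi_surj u; have [y ->] := lpi_surj v.
have [z ->] := lpi_surj w.
by rewrite -linearP !pres_mulE malg_op_linr linearP.
Qed.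

HB.instance Definition _ :=
  isNAAlgebra.Build k presented pres_mul_linl pres_mul_linr.

Lemma pres_namulE g h :
  (lpi ideal g : presented) ** (lpi ideal h : presented) = lpi ideal (malg_op g h).
Proof. exact: pres_mulE. Qed.

Lemma pwordM x y : pword x ** pword y = pword (op x y).
Proof. by rewrite pres_namulE malg_opU. Qed.

Lemma pres_rel r : rel r -> lpi ideal r = 0.
Proof.
by move=> rr; rewrite -(lpi0 ideal); apply/lpi_eq; rewrite subr0; apply: ideal_rel.
Qed.

Lemma pres_ind (A : presented -> Prop) :
  A 0 -> (forall a x u, A u -> A (a *: pword x + u)) -> forall u, A u.
Proof.
move=> A0 Alin u; have [g ->] := lpi_surj u.
elim/malg_ind_lin: g => [|a x g IH]; first by rewrite linear0.
by rewrite linearP; apply: Alin.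
Qed.

End Presented.

Section PresLift.
Variables (k : fieldType) (X : choiceType) (op : X -> X -> X).
Variables (rel : {malg k[X]} -> Prop) (P : lmodType k) (f : X -> P).
Hypothesis f0 : forall g, ideal op rel g -> lin_ext f g = 0.

Definition pres_lift : presented op rel -> P := lquot_lift f0.

HB.instance Definition _ := GRing.Linear.on pres_lift.

Lemma pres_liftE x : pres_lift (pword op rel x) = f x.
Proof. by rewrite /pres_lift /pword lquot_liftE /= lin_extU. Qed.
End PresLift.

Inductive magma (V : Type) := Leaf of V | Node of magma V & magma V.

HB.instance Definition _ (V : Type) := gen_eqMixin (magma V).
HB.instance Definition _ (V : Type) := gen_choiceMixin (magma V).

Section FreeAlgebras.
Variables (k : fieldType) (V : lmodType k).
Local Notation F := {malg k[magma V]}.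
Local Notation "x <.> y" := (malg_op (@Node V) x y)
  (at level 40, left associativity).

Inductive freeLeib_rel : F -> Prop :=
| freeLeib_lin a u v :
    freeLeib_rel (<< Leaf (a *: u + v) >> - (a *: << Leaf u >> + << Leaf v >>))
| freeLeib_leibniz x y z :
    freeLeib_rel (x <.> (y <.> z) - ((x <.> y) <.> z - (x <.> z) <.> y)).

Definition freeLeib := presented (@Node V) freeLeib_rel.
HB.instance Definition _ := NAAlgebra.on freeLeib.

Fact freeLeib_right_leibniz (x y z : freeLeib) :
  x ** (y ** z) = (x ** y) ** z - (x ** z) ** y.
Proof.
have [a ->] := lpi_surj x; have [b ->] := lpi_surj y; have [c ->] := lpi_surj z.
rewrite (pres_namulE _ _ b c) (pres_namulE _ _ a b) (pres_namulE _ _ a c) !pres_namulE.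
apply/eqP; rewrite -subr_eq0 -!linearB; apply/eqP/pres_rel.
exact: freeLeib_leibniz.
Qed.
HB.instance Definition _ := isLeibniz.Build k freeLeib freeLeib_right_leibniz.

Definition freeLeib_gen (v : V) : freeLeib := pword (@Node V) freeLeib_rel (Leaf v).

Inductive freeLie_rel : F -> Prop :=
| freeLie_lin a u v :
    freeLie_rel (<< Leaf (a *: u + v) >> - (a *: << Leaf u >> + << Leaf v >>))
| freeLie_alt x : freeLie_rel (x <.> x)
| freeLie_jacobi x y z :
    freeLie_rel (x <.> (y <.> z) + y <.> (z <.> x) + z <.> (x <.> y)).

Definition freeLie := presented (@Node V) freeLie_rel.
HB.instance Definition _ := NAAlgebra.on freeLie.

Fact freeLie_lie_alt (x : freeLie) : x ** x = 0.
Proof.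
have [a ->] := lpi_surj x; rewrite pres_namulE.
by apply: pres_rel; apply: freeLie_alt.
Qed.

Fact freeLie_lie_jacobi (x y z : freeLie) :
  x ** (y ** z) + y ** (z ** x) + z ** (x ** y) = 0.
Proof.
have [a ->] := lpi_surj x; have [b ->] := lpi_surj y; have [c ->] := lpi_surj z.
rewrite (pres_namulE _ _ b c) (pres_namulE _ _ c a) (pres_namulE _ _ a b) !pres_namulE.
by rewrite -!linearD; apply: pres_rel; apply: freeLie_jacobi.
Qed.
HB.instance Definition _ := isLie.Build k freeLie freeLie_lie_alt freeLie_lie_jacobi.

Definition freeLie_gen (v : V) : freeLie := pword (@Node V) freeLie_rel (Leaf v).

Fixpoint magma_eval (A : naAlgType k) (f : V -> A) (t : magma V) : A :=
  match t with
  | Leaf v => f v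
  | Node l r => magma_eval f l ** magma_eval f r
  end.

Section Univ.
Variables (A : naAlgType k) (f : V -> A) (rel : F -> Prop).
Local Notation ev := (lin_ext (magma_eval f)).

Lemma magma_evalM x y : ev (x <.> y) = ev x ** ev y.
Proof.
elim/malg_ind_lin: x => [|a t x IH].
  by rewrite malg_op.unlock !linear0 namul0l.
rewrite malg_op_linl !linearP /= namul_linl IH lin_extU; congr (_ *: _ + _).
elim/malg_ind_lin: y {IH} => [|b s y IH].
  by rewrite malg_op.unlock lin_extU !linear0.
by rewrite malg_op_linr malg_opU !linearP /= IH !lin_extU.
Qed.

Hypothesis rel0 : forall r, rel r -> ev r = 0.
Local Notation Q := (presented (@Node V) rel).

Lemma magma_univ : exists phi : {linear Q -> A},
  [/\ forall x y, phi (x ** y) = phi x ** phi y,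
      forall v, phi (pword (@Node V) rel (Leaf v)) = f v
    & forall psi : {linear Q -> A},
        (forall x y, psi (x ** y) = psi x ** psi y) ->
        (forall v, psi (pword (@Node V) rel (Leaf v)) = f v) -> psi =1 phi].
Proof.
have ev0 g : ideal (@Node V) rel g -> ev g = 0.
  elim=> [r /rel0 //||a x y _ IHx _ IHy|x y _ IH|x y _ IH].
  - exact: linear0.
  - by rewrite linearP /= IHx IHy scaler0 addr0.
  - by rewrite /= magma_evalM IH namul0r.
  - by rewrite magma_evalM IH namul0l.
exists (pres_lift ev0 : {linear _ -> _}); split=> [x y|v|psi psiM psi_gen].
- have [g ->] := lpi_surj x; have [h ->] := lpi_surj y.
  by rewrite pres_namulE /= /pres_lift !lquot_liftE /= magma_evalM.
- by rewrite /= pres_liftE.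
elim/pres_ind=> [|a t u IH]; first by rewrite !linear0.
rewrite !linearP IH; congr (_ *: _ + _) => {a u IH}.
elim: t => [v|l IHl r IHr]; first by rewrite psi_gen /= pres_liftE.
rewrite /= pres_liftE -pwordM psiM IHl IHr /= !pres_liftE //.
Qed.
End Univ.

Lemma freeLeib_univ (A : leibnizType k) (f : {linear V -> A}) :
  exists phi : {linear freeLeib -> A},
  [/\ forall x y, phi (x ** y) = phi x ** phi y,
      forall v, phi (freeLeib_gen v) = f v
    & forall psi : {linear freeLeib -> A},
        (forall x y, psi (x ** y) = psi x ** psi y) ->
        (forall v, psi (freeLeib_gen v) = f v) -> psi =1 phi].
Proof.
apply: magma_univ => r; case=> [a u v|x y z].
  by rewrite linearB linearP /= !lin_extU /= linearP subrr.
by rewrite !linearB /= !magma_evalM -opprD -right_leibniz subrr.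
Qed.

Lemma freeLie_univ (A : lieType k) (f : {linear V -> A}) :
  exists phi : {linear freeLie -> A},
  [/\ forall x y, phi (x ** y) = phi x ** phi y,
      forall v, phi (freeLie_gen v) = f v
    & forall psi : {linear freeLie -> A},
        (forall x y, psi (x ** y) = psi x ** psi y) ->
        (forall v, psi (freeLie_gen v) = f v) -> psi =1 phi].
Proof.
apply: magma_univ => r; case=> [a u v|x|x y z].
- by rewrite linearB linearP /= !lin_extU /= linearP subrr.
- by rewrite magma_evalM lie_alt.
- by rewrite !linearD /= !magma_evalM lie_jacobi.
Qed.

End FreeAlgebras.

Section Tensor.
Variables (k : fieldType) (U : lmodType k).
Local Notation F := {malg k[seq U]}.

Local Notation "x <.> y" := (malg_op (@cat U) x y)
  (at level 40, left associativity).

Inductive tensor_rel : F -> Prop :=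
| tensor_lin a u v :
    tensor_rel (<< [:: a *: u + v] >> - (a *: << [:: u] >> + << [:: v] >>)).

(* T(U) as the free associative algebra on the set U modulo the linearity of
   U -> T(U). *)
Definition tensor := presented cat tensor_rel.
HB.instance Definition _ := NAAlgebra.on tensor.

(* The word u_1, ..., u_n stands for u_1 \otimes ... \otimes u_n. *)
Definition tens : seq U -> tensor := pword cat tensor_rel.

Lemma tens_namul s t : tens s ** tens t = tens (s ++ t).
Proof. exact: pwordM. Qed.

Fact tensor_mulA : associative (@namul k tensor).
Proof.
have A1 s t z : tens s ** (tens t ** z) = (tens s ** tens t) ** z.
  elim/pres_ind: z => [|a u z IH]; first by rewrite !namul0r.
  by rewrite !namul_linr IH !tens_namul catA.
have A2 s y z : tens s ** (y ** z) = (tens s ** y) ** z.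
  elim/pres_ind: y => [|a t y IH]; first by rewrite namul0l !namul0r namul0l.
  by rewrite namul_linl !namul_linr namul_linl IH A1.
move=> x y z; elim/pres_ind: x => [|a s x IH]; first by rewrite !namul0l.
by rewrite !namul_linl IH A2.
Qed.

Fact tensor_mul1 : left_id (tens [::]) (@namul k tensor).
Proof.
elim/pres_ind=> [|a s x IHx]; first by rewrite namul0r.
by rewrite namul_linr IHx tens_namul.
Qed.

Fact tensor_mulr1 : right_id (tens [::]) (@namul k tensor).
Proof.
elim/pres_ind=> [|a s x IHx]; first by rewrite namul0l.
by rewrite namul_linl IHx tens_namul cats0.
Qed.

Fact tensor_mulDl : left_distributive (@namul k tensor) +%R.
Proof. by move=> x y z; have := namul_linl z 1 x y; rewrite !scale1r. Qed.

Fact tensor_mulDr : right_distributive (@namul k tensor) +%R.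
Proof. by move=> x y z; rewrite linearD. Qed.

Section Lift.
Variables (P : lmodType k) (f : seq U -> P).

Definition multilinear := forall s t a u v,
  f (s ++ (a *: u + v) :: t) = a *: f (s ++ u :: t) + f (s ++ v :: t).

Hypothesis f_lin : multilinear.

Lemma multilinear_ideal g : ideal cat tensor_rel g -> lin_ext f g = 0.
Proof.
move=> Ig; suff gen (s t : seq U) : lin_ext f ((<< s >> <.> g) <.> << t >>) = 0.
  have id_w (h : F) : (<< [::] >> <.> h) <.> << [::] >> = h.
    elim/malg_ind_lin: h => [|a s h IH]; first by rewrite malg_op0r malg_op0l.
    by rewrite malg_op_linr malg_op_linl !malg_opU cats0 IH.
  by rewrite -[g]id_w gen.
have wA1 (p q : seq U) (z : F) :
    << p >> <.> (<< q >> <.> z) = (<< p >> <.> << q >>) <.> z.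
  elim/malg_ind_lin: z => [|a r z IH]; first by rewrite !malg_op0r.
  by rewrite !malg_op_linr IH !malg_opU catA.
have wA2 (p : seq U) (y z : F) : << p >> <.> (y <.> z) = (<< p >> <.> y) <.> z.
  elim/malg_ind_lin: y => [|a q y IH]; first by rewrite malg_op0l !malg_op0r malg_op0l.
  by rewrite malg_op_linl !malg_op_linr malg_op_linl IH wA1.
have wA (x y z : F) : x <.> (y <.> z) = (x <.> y) <.> z.
  elim/malg_ind_lin: x => [|a p x IH]; first by rewrite !malg_op0l.
  by rewrite !malg_op_linl IH wA2.
elim: Ig s t => [r [a u v]||a x y _ IHx _ IHy|x y _ IH|x y _ IH] s t.
- have -> : << [:: a *: u + v] >> - (a *: << [:: u] >> + << [:: v] >>)
    = (-1) *: (a *: << [:: u] >> + << [:: v] >>) + << [:: a *: u + v] >> :> F.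
    by rewrite scaleN1r addrC.
  rewrite !(malg_op_linl, malg_op_linr, malg_opU) !linearP /= !lin_extU.
  by rewrite -!catA /= f_lin scaleN1r addNr.
- by rewrite malg_op0r malg_op0l linear0.
- by rewrite malg_op_linr malg_op_linl linearP /= IHx IHy scaler0 addr0.
- elim/malg_ind_lin: x => [|b p x IHx].
    by rewrite malg_op0l malg_op0r malg_op0l linear0.
  rewrite malg_op_linl malg_op_linr malg_op_linl linearP /= IHx addr0.
  by rewrite wA malg_opU IH scaler0.
elim/malg_ind_lin: y => [|b p y IHy]; first by rewrite !malg_op0r malg_op0l linear0.
rewrite !malg_op_linr malg_op_linl linearP /= IHy addr0.
by rewrite wA -wA malg_opU IH scaler0.
Qed.

Definition tens_lift : tensor -> P := pres_lift multilinear_ideal.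
HB.instance Definition _ := GRing.Linear.on tens_lift.

Lemma tens_liftE s : tens_lift (tens s) = f s.
Proof. exact: pres_liftE. Qed.
End Lift.

Fact tens_nil_neq0 : tens [::] != 0.
Proof.
have f_lin : multilinear (fun s : seq U => (s == [::])%:R : k^o).
  by move=> [|x s] t a u v; rewrite /= scaler0 addr0.
apply/eqP=> /(congr1 (tens_lift f_lin)); rewrite tens_liftE linear0 eqxx.
exact/eqP/oner_neq0.
Qed.

HB.instance Definition _ := GRing.Zmodule_isNzRing.Build tensor
  tensor_mulA tensor_mul1 tensor_mulr1 tensor_mulDl tensor_mulDr tens_nil_neq0.

Fact tensor_scaleAl a (x y : tensor) : a *: (x * y) = (a *: x) * y.
Proof. by have := namul_linl y a x 0; rewrite namul0l !addr0 => /esym. Qed.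

HB.instance Definition _ :=
  GRing.Lmodule_isLalgebra.Build k tensor tensor_scaleAl.

Fact tensor_scaleAr a (x y : tensor) : a *: (x * y) = x * (a *: y).
Proof. by have := namul_linr x a y 0; rewrite namul0r !addr0 => /esym. Qed.

HB.instance Definition _ := GRing.Lalgebra_isAlgebra.Build k tensor tensor_scaleAr.

Lemma tens_cat s t : tens (s ++ t) = tens s * tens t.
Proof. by rewrite -tens_namul. Qed.

Lemma tens_multilinear : multilinear tens.
Proof.
move=> s t a u v; rewrite -(cat1s _ t) -(cat1s u) -(cat1s v) !tens_cat.
have -> : tens [:: a *: u + v] = a *: tens [:: u] + tens [:: v].
  apply/eqP; rewrite -subr_eq0 -linearP -linearB; apply/eqP/pres_rel.
  exact: tensor_lin.
by rewrite mulrDl mulrDr -scalerAl -scalerAr.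
Qed.
End Tensor.

Section SubspaceConstructions.
Variables (k : fieldType) (M : lmodType k).

Fact span_lin (S : M -> Prop) a x y :
  span S x -> span S y -> span S (a *: x + y).
Proof.
move=> Sx Sy; elim: Sx => [|b z x' Sz _ IH]; first by rewrite scaler0 add0r.
by rewrite scalerDr scalerA -addrA; apply: span_cons.
Qed.

Definition subspan (S : M -> Prop) : subspace M :=
  Subspace (span_zero S) (@span_lin S).

Variables N1 N2 : subspace M.

Fact subcap_lin a x y :
  N1 x /\ N2 x -> N1 y /\ N2 y -> N1 (a *: x + y) /\ N2 (a *: x + y).
Proof. by case=> ? ? [? ?]; split; apply: subspace_lin. Qed.

Definition subcap : subspace M :=
  @Subspace k M (fun x => N1 x /\ N2 x)
    (conj (subspace0 N1) (subspace0 N2)) subcap_lin.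
End SubspaceConstructions.

(* The homology, in each degree, of a complex whose degree n part is the
   subspace C n of an ambient space M, with the differential, of degree -1,
   induced by the endomorphism d of M. *)
Section Homology.
Variables (k : fieldType) (M : lmodType k) (d : {linear M -> M}).
Variables (C : int -> subspace M) (n : int).

Fact cycles0 : C n 0 /\ d 0 = 0.
Proof. by split; [exact: subspace0 | exact: linear0]. Qed.

Fact cycles_lin a x y :
  C n x /\ d x = 0 -> C n y /\ d y = 0 ->
  C n (a *: x + y) /\ d (a *: x + y) = 0.
Proof.
move=> [Cx dx] [Cy dy]; split; first exact: subspace_lin.
by rewrite linearP dx dy scaler0 addr0.
Qed.

Definition cycles : subspace M := Subspace cycles0 cycles_lin.

Definition is_boundary (z : subspace_type cycles) : Prop :=
  exists2 y, C (n + 1) y & \val z = d y.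

Fact boundaries0 : is_boundary 0.
Proof. by exists 0; [exact: subspace0 | rewrite !linear0]. Qed.

Fact boundaries_lin a x y :
  is_boundary x -> is_boundary y -> is_boundary (a *: x + y).
Proof.
move=> [x' Cx dx] [y' Cy dy]; exists (a *: x' + y'); first exact: subspace_lin.
by rewrite !linearP -dx -dy.
Qed.

Definition boundaries : subspace (subspace_type cycles) :=
  Subspace boundaries0 boundaries_lin.

Definition homology := lquot boundaries.
HB.instance Definition _ := GRing.Lmodule.on homology.
End Homology.

Section FreeGradedLie.
Variables (k : fieldType) (U : lmodType k).

(* The suspension sU has degree 1, so that T(sU) is graded by word length. *)
Definition tensor_deg (n : int) : subspace (tensor U) :=
  subspan (fun z => exists2 s : seq U, n = (size s)%:Z & z = tens s).

Inductive in_gLie : tensor U -> Prop :=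
| gLie_letter u : in_gLie (tens [:: u])
| gLie_zero : in_gLie 0
| gLie_lin a x y of in_gLie x & in_gLie y : in_gLie (a *: x + y)
| gLie_bracket (p q : nat) x y of
    tensor_deg p x & tensor_deg q y & in_gLie x & in_gLie y :
    in_gLie (x * y - (-1) ^+ (p * q) *: (y * x)).

(* Lie(sU), the Lie subalgebra of T(sU) generated by sU under the graded
   commutator; the latter is only spelled out on homogeneous elements, which
   generates the same subspace. *)
Definition gLie : subspace (tensor U) := Subspace gLie_zero gLie_lin.

Definition gLie_deg (n : int) : subspace (tensor U) := subcap gLie (tensor_deg n).
End FreeGradedLie.

Section LeibnizComplex.
Variables (k : fieldType) (g : leibnizType k).

(* Replaces the i-th letter by its product with the j-th, and drops the j-th;
   letters are numbered from 0. *)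
Definition contract (s : seq g) (i j : nat) : seq g :=
  [seq if m == i then s`_i ** s`_j else s`_m | m <- iota 0 (size s) & m != j].

(* The sign is (-1)^(j+1) when letters are numbered from 1. *)
Definition dLeib_word (s : seq g) : tensor g :=
  \sum_(j < size s) \sum_(i < j) (-1) ^+ j *: tens (contract s i j).

Lemma tens_map_lin (r : seq nat) (q : nat) (F G H : nat -> g) a :
  uniq r -> q \in r ->
  {in r, forall m, m != q -> F m = G m} ->
  {in r, forall m, m != q -> F m = H m} ->
  F q = a *: G q + H q ->
  tens (map F r) = a *: tens (map G r) + tens (map H r).
Proof.
move=> r_uniq /splitPr r_q; case: r_q r_uniq => r1 r2.
rewrite cat_uniq /= => /and3P[_ /norP[qNr1 _] /andP[qNr2 _]] FG FH Fq.
rewrite !map_cat /= Fq tens_multilinear.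
have off (F' : nat -> g) (r' : seq nat) : q \notin r' ->
    {subset r' <= r1 ++ q :: r2} ->
    {in r1 ++ q :: r2, forall m, m != q -> F m = F' m} -> map F r' = map F' r'.
  move=> qNr' sub FF'; apply/eq_in_map=> m r'm; apply: FF'; first exact: sub.
  by apply: contraNneq qNr' => <-.
have sub1 : {subset r1 <= r1 ++ q :: r2} by move=> m; rewrite mem_cat => ->.
have sub2 : {subset r2 <= r1 ++ q :: r2}.
  by move=> m r2m; rewrite mem_cat inE r2m !orbT.
by rewrite -(off G r1) // -(off G r2) // -(off H r1) // -(off H r2).
Qed.

Lemma tens_contract_lin (s t : seq g) a u v (i j : nat) :
  (i < j)%N -> (j < size s + (size t).+1)%N ->
  tens (contract (s ++ (a *: u + v) :: t) i j) =
  a *: tens (contract (s ++ u :: t) i j) + tens (contract (s ++ v :: t) i j).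
Proof.
move=> lt_ij lt_jN; rewrite /contract !size_cat /=; set N := (_ + _)%N in lt_jN *.
have off x y m : m != size s -> (s ++ x :: t)`_m = (s ++ y :: t)`_m.
  rewrite !nth_cat; case: ltngtP => // lt_sm _.
  by rewrite -(subnSK lt_sm).
have at_s x : (s ++ x :: t)`_(size s) = x by rewrite nth_cat ltnn subnn.
have neq_ij : i != j by rewrite ltn_eqF.
have r_uniq : uniq [seq m <- iota 0 N | m != j] by rewrite filter_uniq ?iota_uniq.
have mem m : (m < N)%N -> m != j -> m \in [seq m <- iota 0 N | m != j].
  by move=> ltmN mj; rewrite mem_filter mj mem_iota.
have ltiN : (i < N)%N := ltn_trans lt_ij lt_jN.
have [js|js] := eqVneq j (size s).
  apply: (@tens_map_lin _ i) => //; first exact: mem.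
  - by move=> m; rewrite mem_filter js => /andP[ms _] /negPf ->; apply: off.
  - by move=> m; rewrite mem_filter js => /andP[ms _] /negPf ->; apply: off.
  rewrite !eqxx js !at_s (off _ 0) -?js // (off u 0) -?js // (off v 0) -?js //.
  exact: namul_linr.
apply: (@tens_map_lin _ (size s)) => //.
- by apply: mem; [rewrite /N addnS ltnS leq_addr | rewrite eq_sym].
- by move=> m _ ms; rewrite (off _ u m ms) (off _ u j js); have [<-|//] := eqVneq m i;
    rewrite (off _ u m ms).
- by move=> m _ ms; rewrite (off _ v m ms) (off _ v j js); have [<-|//] := eqVneq m i;
    rewrite (off _ v m ms).
have [<-|_] := eqVneq; last by rewrite !at_s.
by rewrite !at_s (off _ 0 j js) (off u 0 j js) (off v 0 j js) namul_linl.
Qed.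

Fact dLeib_word_multilinear : multilinear dLeib_word.
Proof.
move=> s t a u v; rewrite /dLeib_word !size_cat /=.
rewrite scaler_sumr -big_split /=; apply: eq_bigr => j _.
rewrite scaler_sumr -big_split /=; apply: eq_bigr => i _.
by rewrite tens_contract_lin // scalerDr !scalerA [a * _]mulrC.
Qed.

Definition dLeib : tensor g -> tensor g := tens_lift dLeib_word_multilinear.
HB.instance Definition _ := GRing.Linear.on dLeib.

Lemma dLeibE s : dLeib (tens s) = dLeib_word s.
Proof. exact: tens_liftE. Qed.

Definition pirashvili_homology (n : int) : lmodType k :=
  homology dLeib (@gLie_deg k g) n.
End LeibnizComplex.

Definition lmod_isomorphic (k : fieldType) (U W : lmodType k) : Prop :=
  exists f : {linear U -> W}, bijective f.

(* Main.v *)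
(* Write g = Leib(V) and T = T(sg).  On words, d (X sy) = dX sy + sigma(X).y, where
   sigma is the parity automorphism and X.y the action of y on T by derivations.  The
   Pirashvili complex, augmented by Lie(V), is the free Lie superalgebra on V + sV with
   the derivation sv |-> v (Lazard elimination); the odd derivation v |-> sv contracts
   it, up to multiplication by the total V-weight.  Transported to T, the contraction
   is the odd derivation h with h (sx) = eta x, where
     theta (xy) = (theta x) y - (theta y) x,    theta v = v,
     eta (xy) = (eta x).y - [sx, s (theta y)],  eta v = 0,
   and on Lie(sg) one gets d h + h d = N - s theta pr1, with N the weight derivation
   and pr1 the projection onto words of length 1.  Away from degree 1 cycles are thus
   boundaries, as N is locally finite with positive eigenvalues.  In degree 1 the
   boundaries are the span of the xy + yx, which is the kernel of g -> Lie(V). *)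
From HB Require Import structures.
Require Import Defs.
From mathcomp Require Import all_boot all_order all_algebra.
From mathcomp.multinomials Require Import monalg.

Set Implicit Arguments.
Unset Strict Implicit.
Unset Printing Implicit Defensive.

Import GRing.Theory.
Local Open Scope ring_scope.

(** * The tensor algebra *)

Section Bilinear.
Variables (k : fieldType) (A B : algType k) (P : lmodType k).

Definition bilin (Q : lmodType k) (b : A -> A -> Q) :=
  (forall y, linear (b^~ y)) /\ (forall x, linear (b x)).

Lemma bilin_mulr (f : {linear A -> P}) : bilin (fun x y => f (x * y)).
Proof.
split=> z a x y; first by rewrite mulrDl -scalerAl linearP.
by rewrite mulrDr -scalerAr linearP.
Qed.

Lemma bilin_mul (f g : {linear A -> B}) : bilin (fun x y => f x * g y).
Proof.
split=> z a x y; first by rewrite linearP mulrDl -scalerAl.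
by rewrite linearP mulrDr -scalerAr.
Qed.

Lemma bilin_scale (f : {linear A -> k^o}) (g : {linear A -> P}) :
  bilin (fun x y => f x *: g y).
Proof.
split=> z a x y; first by rewrite linearP scalerDl scalerA.
by rewrite linearP scalerDr !scalerA mulrC.
Qed.

Lemma bilin_swap (b : A -> A -> P) : bilin b -> bilin (fun x y => b y x).
Proof. by case=> bl br; split. Qed.

Lemma bilin_add (b c : A -> A -> P) :
  bilin b -> bilin c -> bilin (fun x y => b x y + c x y).
Proof.
move=> [bl br] [cl cr]; split=> z a x y.
  by rewrite bl cl scalerDr addrACA.
by rewrite br cr scalerDr addrACA.
Qed.

Lemma bilin0l (b : A -> A -> P) y : bilin b -> b 0 y = 0.
Proof. by case=> /(_ y (-1) 0 0); rewrite !scaleN1r !addNr. Qed.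

Lemma bilin0r (b : A -> A -> P) x : bilin b -> b x 0 = 0.
Proof. by case=> _ /(_ x (-1) 0 0); rewrite !scaleN1r !addNr. Qed.

Lemma twisted_leibniz_lin c a (x y u v z w : A) :
  (a *: x + y) * z + c *: ((a *: u + v) * w) =
  a *: (x * z + c *: (u * w)) + (y * z + c *: (v * w)).
Proof.
by rewrite !mulrDl -!scalerAl !scalerDr !scalerA [c * a]mulrC addrACA.
Qed.

Lemma twisted_leibniz_linr c a (x u v z w w' : A) :
  x * (a *: u + v) + c *: (z * (a *: w + w')) =
  a *: (x * u + c *: (z * w)) + (x * v + c *: (z * w')).
Proof.
by rewrite !mulrDr -!scalerAr !scalerDr !scalerA [c * a]mulrC addrACA.
Qed.

Lemma mulr_comp_linear (f : {linear A -> P}) y : linear (fun x => f (x * y)).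
Proof. exact: (bilin_mulr f).1. Qed.

Lemma mulr_add_linear (f e : {linear A -> A}) y :
  linear (fun x => f x * y + e x).
Proof.
by move=> a u v; rewrite !linearP mulrDl -scalerAl scalerDr addrACA.
Qed.

End Bilinear.

Lemma span_incl (k : fieldType) (M : lmodType k) (S : M -> Prop) x :
  S x -> Defs.span S x.
Proof.
by move=> Sx; rewrite -[x]scale1r -[1 *: x]addr0;
  apply: Defs.span_cons (Defs.span_zero S).
Qed.

Section TensorAlgebra.
Variables (k : fieldType) (U : lmodType k).
Local Notation T := (tensor U).

Definition letter (x : U) : T := tens [:: x].

Fact letter_is_linear : linear letter.
Proof. by move=> a x y; apply: (@tens_multilinear k U [::] [::]). Qed.
HB.instance Definition _ :=
  GRing.isLinear.Build k U T _ letter letter_is_linear.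

Lemma tens_cons x s : tens (x :: s) = letter x * tens s.
Proof. exact: (@tens_cat _ _ [:: x] s). Qed.

Lemma tens_rcons s x : tens (rcons s x) = tens s * letter x.
Proof. by rewrite -cats1 tens_cat. Qed.

Lemma tens_nil : tens [::] = 1 :> T. Proof. by []. Qed.

Lemma tensor_ind (A : T -> Prop) :
  A 0 -> (forall a x y, A x -> A y -> A (a *: x + y)) ->
  (forall s, A (tens s)) -> forall x, A x.
Proof. by move=> A0 Alin At; elim/pres_ind=> // a s x; apply: Alin (At s). Qed.

Lemma tens_lift_unique (P : lmodType k) (f g : {linear T -> P}) :
  (forall s, f (tens s) = g (tens s)) -> f =1 g.
Proof.
move=> fg; elim/tensor_ind=> // [|a x y fx fy]; first by rewrite !linear0.
by rewrite !linearP fx fy.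
Qed.

Lemma tens_lift_unique_fun (P : lmodType k) (f g : T -> P) :
  linear f -> linear g -> (forall s, f (tens s) = g (tens s)) -> f =1 g.
Proof.
have lin0 (e : T -> P) : linear e -> e 0 = 0.
  by move=> /(_ (-1) 0 0); rewrite !scaleN1r !addNr.
move=> lf lg fg; elim/tensor_ind=> // [|a x y fx fy]; first by rewrite !lin0.
by rewrite lf lg fx fy.
Qed.

(** This reduces the product rules [tscaleM], [tderM], [augM] and [pr1M] to pairs of words, where
    they are computations with concatenation. *)
Lemma bilin_tens_ext (P : lmodType k) (b c : T -> T -> P) :
  bilin b -> bilin c ->
  (forall s t, b (tens s) (tens t) = c (tens s) (tens t)) ->
  forall x y, b x y = c x y.
Proof.
move=> Hb Hc bc x y; elim/tensor_ind: x => [|a x x' IH IH'|s].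
- by rewrite !bilin0l.
- by rewrite Hb.1 Hc.1 IH IH'.
elim/tensor_ind: y => [|a y y' IH IH'|t //].
- by rewrite !bilin0r.
by rewrite Hb.2 Hc.2 IH IH'.
Qed.

Section Scaling.
Variable c : k.

Fact tscale_word_multilinear :
  multilinear (fun s : seq U => c ^+ size s *: tens s).
Proof.
move=> s t a u v; rewrite tens_multilinear !size_cat /= scalerDr !scalerA.
by rewrite mulrC.
Qed.

(** For [c = -1] this is the parity automorphism sigma of the Koszul sign rule. For [c = 1] it is
    the identity, so that [tder] covers ordinary and odd derivations alike. *)
Definition tscale : T -> T := tens_lift tscale_word_multilinear.
HB.instance Definition _ := GRing.Linear.on tscale.

Lemma tscaleE s : tscale (tens s) = c ^+ size s *: tens s.
Proof. exact: tens_liftE. Qed.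

Lemma tscale1 : tscale 1 = 1.
Proof. by rewrite -tens_nil tscaleE scale1r. Qed.

Lemma tscale_letter x : tscale (letter x) = c *: letter x.
Proof. exact: tscaleE. Qed.

Lemma tscaleM x y : tscale (x * y) = tscale x * tscale y.
Proof.
pose b x y := tscale (x * y); pose b' x y := tscale x * tscale y.
apply: (@bilin_tens_ext _ b b') x y; rewrite /b /b'.
- exact: bilin_mulr.
- exact: bilin_mul.
move=> s t; rewrite -tens_cat !tscaleE -scalerAl -scalerAr scalerA -exprD.
by rewrite -tens_cat size_cat.
Qed.

End Scaling.

Lemma tscale_id x : tscale 1 x = x.
Proof.
apply: (@tens_lift_unique _ (tscale 1) idfun) => s.
by rewrite [LHS]tscaleE expr1n scale1r.
Qed.

Section TwistedDerivation.
Variables (c : k) (f : U -> T).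
Hypothesis f_lin : linear f.

(** The value on a word of the derivation, twisted by [tscale c], that extends [f]: ordinary for
    [c = 1], odd for [c = -1]. *)
Fixpoint tder_word (s : seq U) : T :=
  if s is x :: s' then f x * tens s' + c *: (letter x * tder_word s') else 0.

Fact tder_word_multilinear : multilinear tder_word.
Proof.
move=> s t a u v; elim: s => [|x s IH] /=.
  by rewrite f_lin linearP twisted_leibniz_lin.
by rewrite IH tens_multilinear twisted_leibniz_linr.
Qed.

Definition tder : T -> T := tens_lift tder_word_multilinear.
HB.instance Definition _ := GRing.Linear.on tder.

Lemma tder_nil : tder 1 = 0.
Proof. exact: tens_liftE. Qed.

Lemma tder_letter x : tder (letter x) = f x.
Proof. by rewrite /tder tens_liftE /= mulr0 scaler0 addr0 mulr1. Qed.

Lemma tderM x y : tder (x * y) = tder x * y + tscale c x * tder y.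
Proof.
pose b x y := tder (x * y); pose b' x y := tder x * y + tscale c x * tder y.
apply: (@bilin_tens_ext _ b b') x y; rewrite /b /b'.
- exact: bilin_mulr.
- apply: (@bilin_add _ _ _ (fun x y => tder x * y)); last exact: bilin_mul.
  exact: (bilin_mul tder idfun).
move=> s t; rewrite -tens_cat tscaleE /tder !tens_liftE -scalerAl.
elim: s => [|x s IH] /=; first by rewrite mul0r add0r scale1r mul1r.
rewrite IH tens_cat mulrDl mulrDr scalerDr !mulrA -addrA -scalerAl.
by rewrite -scalerAr scalerA tens_cons mulrA -exprS.
Qed.

End TwistedDerivation.

Fact aug_word_multilinear : multilinear (fun s : seq U => (s == [::])%:R : k^o).
Proof. by move=> [|x s] t a u v; rewrite /= scaler0 addr0. Qed.

Definition aug : T -> k^o := tens_lift aug_word_multilinear.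
HB.instance Definition _ := GRing.Linear.on aug.

Lemma augE s : aug (tens s) = (s == [::])%:R. Proof. exact: tens_liftE. Qed.

Definition letter_word (s : seq U) : U := if s is [:: x] then x else 0.

Fact letter_word_multilinear : multilinear letter_word.
Proof.
by move=> [|x [|y s]] [|z t] a u v //=; rewrite ?scaler0 ?addr0.
Qed.

Definition pr1 : T -> U := tens_lift letter_word_multilinear.
HB.instance Definition _ := GRing.Linear.on pr1.

Lemma pr1E s : pr1 (tens s) = letter_word s. Proof. exact: tens_liftE. Qed.

Lemma pr1_letter x : pr1 (letter x) = x. Proof. exact: pr1E. Qed.

Lemma aug_letter x : aug (letter x) = 0. Proof. exact: augE. Qed.

Lemma augM x y : aug (x * y) = aug x * aug y.
Proof.
pose b x y := aug (x * y); pose b' x y := aug x *: aug y.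
apply: (@bilin_tens_ext _ b b') x y; rewrite /b /b'.
- exact: bilin_mulr.
- exact: bilin_scale.
move=> s t; rewrite -tens_cat !augE.
by case: s t => [|? ?] [|? ?]; rewrite ?scale1r ?scale0r.
Qed.

(** A letter arises in [x * y] only as a letter of one factor times the constant term of the other:
    [pr1] is a derivation along the augmentation. *)
Lemma pr1M x y : pr1 (x * y) = aug x *: pr1 y + aug y *: pr1 x.
Proof.
pose b x y := pr1 (x * y); pose b' x y := aug x *: pr1 y + aug y *: pr1 x.
apply: (@bilin_tens_ext _ b b') x y; rewrite /b /b'.
- exact: bilin_mulr.
- apply: (@bilin_add _ _ _ (fun x y => aug x *: pr1 y)); first exact: bilin_scale.
  exact: (bilin_swap (bilin_scale aug pr1)).
move=> s t; rewrite -tens_cat !pr1E !augE.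
by case: s t => [|x [|x' s]] [|y [|y' t]] /=;
  rewrite ?scale1r ?scale0r ?scaler0 ?addr0 ?add0r ?cats0.
Qed.

Lemma tensor_deg_ind (A : T -> Prop) n :
  A 0 -> (forall a x y, A x -> A y -> A (a *: x + y)) ->
  (forall s, n = (size s)%:Z -> A (tens s)) -> forall x, tensor_deg U n x -> A x.
Proof.
move=> A0 Alin At x; elim=> // a y z [s ns ->] _; apply: Alin; exact: At.
Qed.

Lemma tensor_deg_tens s : tensor_deg U (size s)%:Z (tens s).
Proof.
by apply: span_incl; exists s.
Qed.

Lemma tensor_deg_letter x : tensor_deg U 1 (letter x).
Proof. exact: (tensor_deg_tens [:: x]). Qed.

Lemma tensor_degM p q x y :
  tensor_deg U p x -> tensor_deg U q y -> tensor_deg U (p + q) (x * y).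
Proof.
move=> Tx Ty; elim/tensor_deg_ind: x / Tx => [|a x x' IHx IHx'|s ->].
- by rewrite mul0r; apply: subspace0.
- by rewrite mulrDl -scalerAl; apply: subspace_lin.
elim/tensor_deg_ind: y / Ty => [|a y y' IHy IHy'|t ->].
- by rewrite mulr0; apply: subspace0.
- by rewrite mulrDr -scalerAr; apply: subspace_lin.
by rewrite -tens_cat -PoszD -size_cat; apply: tensor_deg_tens.
Qed.

Lemma tscale_deg c (p : nat) x : tensor_deg U p x -> tscale c x = c ^+ p *: x.
Proof.
move=> Tx; elim/tensor_deg_ind: x / Tx => [|a x y IHx IHy|s [->]].
- by rewrite linear0 scaler0.
- by rewrite linearP /= IHx IHy scalerDr !scalerA mulrC.
exact: tscaleE.
Qed.

Lemma pr1_deg n x : n != 1 -> tensor_deg U n x -> pr1 x = 0.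
Proof.
move=> n1 Tx; elim/tensor_deg_ind: x / Tx => [|a x y IHx IHy|s ns].
- exact: linear0.
- by rewrite linearP /= IHx IHy scaler0 addr0.
by rewrite pr1E; case: s ns n1 => [|? [|? ?]] // ->; rewrite eqxx.
Qed.

Lemma letter_pr1 x : tensor_deg U 1 x -> letter (pr1 x) = x.
Proof.
move=> Tx; elim/tensor_deg_ind: x / Tx => [|a x y IHx IHy|s ns].
- by rewrite !linear0.
- by rewrite !linearP /= IHx IHy.
by case: s ns => [|x [|? ?]] //; rewrite pr1_letter.
Qed.

End TensorAlgebra.

Section LetterDerivation.
Variables (k : fieldType) (U : lmodType k).
Local Notation T := (tensor U).

(** The shift [m] is 0 for derivations induced by maps of letters to letters, and 1 for the
    homotopy, which replaces a letter by an element of degree 2. *)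
Lemma tder_deg (c : k) (f : U -> T) (f_lin : linear f) (m n : int) x :
  (forall u, tensor_deg U (1 + m) (f u)) -> tensor_deg U n x ->
  tensor_deg U (n + m) (tder c f_lin x).
Proof.
move=> fm Tx; elim/tensor_deg_ind: x / Tx => [|a x y IHx IHy|s ->].
- by rewrite linear0; apply: subspace0.
- by rewrite linearP; apply: subspace_lin.
rewrite /tder tens_liftE; elim: s => [|x s IH]; first exact: subspace0.
rewrite [tder_word c f _]/= [f x * _ + _]addrC; apply: subspace_lin.
  have -> : Posz (size (x :: s)) + m = 1 + ((size s)%:Z + m) by rewrite addrA.
  exact: tensor_degM (tensor_deg_letter x) IH.
have -> : Posz (size (x :: s)) + m = 1 + m + (size s)%:Z by rewrite addrAC.
exact: tensor_degM (fm x) (tensor_deg_tens s).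
Qed.

Section One.
Variables (f : U -> U) (f_lin : linear f).

Fact letter_comp_linear : linear (fun x => letter (f x)).
Proof. by move=> a x y; rewrite f_lin linearP. Qed.

Definition lder : T -> T := tder 1 letter_comp_linear.
HB.instance Definition _ := GRing.Linear.on lder.

Lemma lder1 : lder 1 = 0. Proof. exact: tder_nil. Qed.

Lemma lder_letter x : lder (letter x) = letter (f x).
Proof. exact: tder_letter. Qed.

Lemma lderM x y : lder (x * y) = lder x * y + x * lder y.
Proof. by rewrite /lder tderM tscale_id. Qed.

Lemma lder_deg n x : tensor_deg U n x -> tensor_deg U n (lder x).
Proof.
move=> Tx; rewrite -[n]addr0; apply: tder_deg Tx => u.
exact: tensor_deg_letter.
Qed.

End One.

End LetterDerivation.

(** * The Leibniz differential, one letter at a time *)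

Section LeibnizDifferential.
Variables (k : fieldType) (g : leibnizType k).
Local Notation T := (tensor g).
Local Notation sgn := (tscale (-1)).
Local Notation d := (@dLeib k g).

Definition act (y : g) : T -> T := lder (namul_linl y).
HB.instance Definition _ y := GRing.Linear.on (act y).

Lemma actZ y a x : act y (a *: x) = a *: act y x.
Proof. exact: linearZZ. Qed.

Lemma map_iotaS (X : Type) (F : nat -> X) n :
  map F (iota 0 n.+1) = F 0%N :: map (fun m => F m.+1) (iota 0 n).
Proof. by rewrite [iota 0 n.+1]/= map_cons (iotaDl 1 0) -map_comp. Qed.

(** Positions are indexed as in [contract], so that the summands agree with [contract_last] one by
    one. *)
Lemma act_tens y s : act y (tens s) =
  \sum_(i < size s)
     tens [seq if m == i :> nat then s`_m ** y else s`_m | m <- iota 0 (size s)].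
Proof.
elim: s => [|x s IH]; first by rewrite /act lder1 big_ord0.
have sz : size (x :: s) = (size s).+1 by [].
rewrite tens_cons /act lderM lder_letter -tens_cons sz big_ord_recl.
congr (_ + _).
  by rewrite map_iotaS; congr (tens (_ :: _)); rewrite map_nth_iota0 ?take_size.
rewrite -/(act y) IH mulr_sumr; apply: eq_bigr => i _.
by rewrite -tens_cons map_iotaS.
Qed.

Lemma contract_rcons (s : seq g) y (i j : nat) : (i < j)%N -> (j < size s)%N ->
  contract (rcons s y) i j = rcons (contract s i j) y.
Proof.
move=> ij js; rewrite /contract size_rcons -addn1 iotaD cats1 filter_rcons add0n.
have -> : size s != j by rewrite gtn_eqF.
rewrite map_rcons gtn_eqF ?(ltn_trans ij js) //.
rewrite [(rcons s y)`_(size s)]nth_rcons ltnn eqxx.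
congr rcons; apply/eq_in_map=> m; rewrite mem_filter mem_iota /= => /andP[_ ms].
by rewrite !nth_rcons ms js (ltn_trans ij js).
Qed.

Lemma contract_last (s : seq g) y (i : nat) : (i < size s)%N ->
  contract (rcons s y) i (size s) =
  [seq if m == i :> nat then s`_m ** y else s`_m | m <- iota 0 (size s)].
Proof.
move=> lt_is; rewrite /contract size_rcons -addn1 iotaD cats1 filter_rcons add0n.
rewrite eqxx /=; have -> : [seq m <- iota 0 (size s) | m != size s] = iota 0 (size s).
  by apply/all_filterP/allP => m; rewrite mem_iota => /= ms; rewrite ltn_eqF.
apply/eq_in_map=> m; rewrite mem_iota /= => ms.
by rewrite !nth_rcons ms lt_is ltnn eqxx; case: eqP => // ->.
Qed.

Lemma dLeib1 : d 1 = 0.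
Proof. by rewrite -tens_nil dLeibE /dLeib_word big_ord0. Qed.

(** The terms that drop a letter of [x] give [d x]. Those that drop [y] multiply each letter of [x]
    by [y] in turn, all with the sign [(-1) ^+ size s], which [sgn] supplies. With [dLeib1] this
    recursion determines [d], and nothing else about the explicit sum is used later. *)
Lemma dLeib_mul_letter x y :
  d (x * letter y) = d x * letter y + act y (sgn x).
Proof.
apply: (@tens_lift_unique_fun _ _ _ (fun x => d (x * letter y))
  (fun x => d x * letter y + act y (sgn x))) x.
- exact: mulr_comp_linear.
- exact: (mulr_add_linear d (act y \o sgn)).
move=> s; rewrite -tens_rcons !dLeibE /dLeib_word size_rcons big_ord_recr /= tscaleE.
congr (_ + _).
  rewrite mulr_suml; apply: eq_bigr => j _; rewrite mulr_suml; apply: eq_bigr => i _.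
  by rewrite -scalerAl contract_rcons // tens_rcons.
rewrite actZ act_tens scaler_sumr; apply: eq_bigr => i _.
by rewrite contract_last.
Qed.

(** Letters are split off on the right because the recursion for [d] does so. *)
Lemma tensor_ind_rcons (A : T -> Prop) :
  A 0 -> (forall a x y, A x -> A y -> A (a *: x + y)) ->
  A 1 -> (forall x y, A x -> A (x * letter y)) -> forall x, A x.
Proof.
move=> A0 Alin A1 Ar; elim/tensor_ind=> // s.
by elim/last_ind: s => // s x IH; rewrite tens_rcons; apply: Ar.
Qed.

End LeibnizDifferential.

(** * Sums of eigenvectors with positive integral eigenvalues *)

Section Weights.
Variables (k : fieldType) (M : lmodType k) (N : {linear M -> M}).

Definition weighted : subspace M :=
  subspan (fun x => exists2 w : nat, (0 < w)%N & N x = w%:R *: x).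

(** Eigenvalues of a derivation add under the product. The product [m] is arbitrary so as to serve
    both for [g] and for [T]. *)
Lemma weighted_mul (m : M -> M -> M) :
  (forall y, linear (m^~ y)) -> (forall x, linear (m x)) ->
  (forall x y, N (m x y) = m (N x) y + m x (N y)) ->
  forall x y, weighted x -> weighted y -> weighted (m x y).
Proof.
move=> ml mr mN x y Wx Wy.
have m0l z : m 0 z = 0 by have := ml z (-1) 0 0; rewrite !scaleN1r !addNr.
have m0r z : m z 0 = 0 by have := mr z (-1) 0 0; rewrite !scaleN1r !addNr.
have mZl a u v : m (a *: u) v = a *: m u v by rewrite -[_ *: u]addr0 ml m0l addr0.
have mZr a u v : m u (a *: v) = a *: m u v by rewrite -[_ *: v]addr0 mr m0r addr0.
elim: Wx => [|a u x' [w w0 Nu] _ IH]; first by rewrite m0l; apply: subspace0.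
rewrite ml; apply: subspace_lin IH => {x'}.
elim: Wy => [|b v y' [w' w'0 Nv] _ IH]; first by rewrite m0r; apply: subspace0.
rewrite mr; apply: subspace_lin IH; apply: span_incl.
exists (w + w')%N; first by rewrite addn_gt0 w0.
by rewrite mN Nu Nv mZl mZr natrD scalerDl.
Qed.

(* If x is killed by a product of operators N - w, then (N - w) x lies in B by induction
   on the number of factors, and so does N x, hence w x. *)
Lemma weighted_descent (Z B : subspace M) :
  (forall n, (0 < n)%N -> n%:R != 0 :> k) ->
  (forall x, Z x -> Z (N x)) -> (forall x, Z x -> B (N x)) ->
  forall x, weighted x -> Z x -> B x.
Proof.
move=> char0 NZ NB.
pose shift (w : nat) (x : M) := N x - w%:R *: x.
pose ann := foldl (fun y w => shift w y).
have shift_lin w : linear (shift w).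
  move=> a x y; rewrite /shift linearP scalerDr opprD addrACA scalerBr !scalerA.
  by rewrite mulrC.
have shiftC w w' x : shift w (shift w' x) = shift w' (shift w x).
  rewrite /shift !(linearB N) !(linearZZ N) !scalerBr !scalerA !opprB [w'%:R * _]mulrC.
  by rewrite !addrA [LHS](ACl (1 * 4 * 3 * 2)).
have shift0 w : shift w 0 = 0 by rewrite /shift linear0 scaler0 subr0.
have annC s w x : ann (shift w x) s = shift w (ann x s).
  by elim: s x => //= w' s IH x; rewrite -IH shiftC.
have key s x : all (leq 1) s -> ann x s = 0 -> Z x -> B x.
  elim: s x => [|w s IH] x /=; first by move=> _ -> _; apply: subspace0.
  case/andP=> w0 s0 ann_x Zx; have Bs : B (shift w x).
    apply: IH => //; rewrite /shift addrC -scaleNr; apply: subspace_lin => //.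
    exact: NZ.
  have -> : x = w%:R^-1 *: ((-1) *: shift w x + N x) + 0.
    rewrite scaleN1r opprB subrK scalerA mulVf ?scale1r ?addr0 //; exact: char0.
  by apply: subspace_lin (subspace0 B); apply: subspace_lin => //; apply: NB.
(* The factors are the eigenvalues of the summands of [x]; since the shifts commute, each summand
   meets the one that kills it. *)
move=> x Wx; suff [s [s0 ann_x]] : exists s, all (leq 1) s /\ ann x s = 0.
  exact: key s0 ann_x.
elim: Wx => [|a u y [w w0 Nu] _ [s [s0 ann_y]]]; first by exists [::].
exists (w :: s); split; first by rewrite /= w0.
have u0 : shift w u = 0 by rewrite /shift Nu subrr.
rewrite -[LHS]/(ann (shift w (a *: u + y)) s) shift_lin u0 scaler0 add0r.
by rewrite annC ann_y shift0.
Qed.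

End Weights.

(** * The contracting homotopy *)

(* T is T(sg), with l the inclusion of letters; it is kept abstract because unification
   on the type [tensor g], a quotient, is very slow. *)
Section AbstractLeibnizComplex.
Variables (k : fieldType) (g : leibnizType k) (T : algType k).
Variable l : {linear g -> T}.
Hypothesis T_ind : forall A : T -> Prop,
  A 0 -> (forall a x y, A x -> A y -> A (a *: x + y)) ->
  A 1 -> (forall x y, A x -> A (x * l y)) -> forall x, A x.

Definition is_deriv (f : g -> g) (D : {linear T -> T}) :=
  (forall x y, D (x * y) = D x * y + x * D y) /\ (forall u, D (l u) = l (f u)).

Lemma deriv1 f D : is_deriv f D -> D 1 = 0.
Proof.
by case=> DM _; have := DM 1 1; rewrite !mulr1 mul1r -[LHS]addr0 => /addrI.
Qed.

(** The commutator of two derivations is a derivation, so it suffices to compare values on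
    letters. *)
Lemma deriv_commutator f f' f'' D D' D'' :
  is_deriv f D -> is_deriv f' D' -> is_deriv f'' D'' ->
  (forall u, f (f' u) = f' (f u) + f'' u) ->
  forall x, D (D' x) = D' (D x) + D'' x.
Proof.
move=> dD dD' dD'' ff; have [DM Dl] := dD; have [D'M D'l] := dD'.
have [D''M D''l] := dD''.
elim/T_ind=> [|a x y IHx IHy||x u IH].
- by rewrite !linear0 addr0.
- by rewrite !linearP IHx IHy /= scalerDr addrACA.
- by rewrite (deriv1 dD) (deriv1 dD') (deriv1 dD'') !linear0 addr0.
rewrite D'M DM D''M !linearD /= !DM !D'M IH !(Dl, D'l, D''l) ff linearD /=.
by rewrite mulrDl mulrDr !addrA [LHS](ACl (1 * 4 * 3 * 5 * 2 * 6)).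
Qed.

Variables (sgn : {linear T -> T}) (aug : {linear T -> k^o}) (pr1 : {linear T -> g}).
Hypotheses (sgn1 : sgn 1 = 1) (sgnM : forall x y, sgn (x * y) = sgn x * sgn y).
Hypothesis sgn_l : forall u, sgn (l u) = - l u.
Hypotheses (augM : forall x y, aug (x * y) = aug x * aug y).
Hypothesis aug_l : forall u, aug (l u) = 0.
Hypothesis pr1M : forall x y,
  pr1 (x * y) = (aug x : k) *: (pr1 y : g) + (aug y : k) *: (pr1 x : g).
Hypothesis pr1_l : forall u, pr1 (l u) = u.

Lemma sgnK x : sgn (sgn x) = x.
Proof.
elim/T_ind: x => [|a x y IHx IHy||x u IH].
- by rewrite !linear0.
- by rewrite !linearP /= IHx IHy.
- by rewrite !sgn1.
by rewrite !sgnM !sgn_l linearN /= sgn_l opprK IH.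
Qed.

Lemma deriv_sgn f D : is_deriv f D -> forall x, D (sgn x) = sgn (D x).
Proof.
move=> dD; have [DM Dl] := dD; elim/T_ind=> [|a x y IHx IHy||x u IH].
- by rewrite !linear0.
- by rewrite !linearP IHx IHy.
- by rewrite sgn1 (deriv1 dD) linear0.
by rewrite sgnM !DM linearD /= !sgnM Dl IH !sgn_l linearN /= Dl.
Qed.

Lemma aug_deriv f D x : is_deriv f D -> aug (D x) = 0.
Proof.
move=> dD; have [DM Dl] := dD; elim/T_ind: x => [|a x y IHx IHy||x u IH].
- by rewrite !linear0.
- by rewrite !linearP /= IHx IHy scaler0 addr0.
- by rewrite (deriv1 dD) linear0.
by rewrite DM linearD /= !augM Dl !aug_l !mulr0 addr0.
Qed.

(** * The action of [g] by derivations, and the differential *)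

Variable act : g -> {linear T -> T}.
Hypothesis act_deriv : forall y, is_deriv (fun x => x ** y) (act y).

Let act_l y u : act y (l u) = l (u ** y). Proof. by case: (act_deriv y). Qed.
Let act_mul y x x' : act y (x * x') = act y x * x' + x * act y x'.
Proof. by case: (act_deriv y). Qed.
Let act_sgn y x : act y (sgn x) = sgn (act y x).
Proof. exact: deriv_sgn (act_deriv y) x. Qed.

(** On letters this is the Leibniz identity. *)
Lemma act_act y z x : act z (act y x) = act y (act z x) + act (y ** z) x.
Proof.
apply: (deriv_commutator (act_deriv z) (act_deriv y) (act_deriv (y ** z))) => u.
by rewrite right_leibniz addrC subrK.
Qed.

Lemma act0 x : act 0 x = 0.
Proof.
elim/T_ind: x => [|a x y IHx IHy||x u IH]; first exact: linear0.
- by rewrite linearP IHx IHy scaler0 addr0.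
- exact: deriv1 (act_deriv 0).
by rewrite act_mul IH act_l namul0r linear0 mulr0 mul0r addr0.
Qed.

Variable d : {linear T -> T}.
Hypothesis d1 : d 1 = 0.
Hypothesis d_mul_l : forall x y, d (x * l y) = d x * l y + act y (sgn x).

Lemma d_l y : d (l y) = 0.
Proof.
by rewrite -[l y]mul1r d_mul_l d1 mul0r sgn1 (deriv1 (act_deriv y)) addr0.
Qed.

Lemma d_sgn x : d (sgn x) = - sgn (d x).
Proof.
elim/T_ind: x => [|a x y IHx IHy||x u IH].
- by rewrite !linear0.
- by rewrite !(linearP sgn, linearP d) /= IHx IHy scalerN opprD.
- by rewrite sgn1 d1 !linear0.
rewrite sgnM sgn_l mulrN linearN /= !d_mul_l (linearD sgn) /= sgnM IH sgn_l sgnK.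
by rewrite -act_sgn sgnK mulNr mulrN.
Qed.

Lemma aug_d x : aug (d x) = 0.
Proof.
elim/T_ind: x => [|a x y IHx IHy||x u IH].
- by rewrite !linear0.
- by rewrite !linearP /= IHx IHy scaler0 addr0.
- by rewrite d1 linear0.
by rewrite d_mul_l linearD /= augM IH mul0r add0r (aug_deriv _ (act_deriv u)).
Qed.

Lemma d_act z x : d (act z x) = act z (d x).
Proof.
elim/T_ind: x => [|a x y IHx IHy||x u IH].
- by rewrite !linear0.
- by rewrite !linearP IHx IHy.
- by rewrite d1 (deriv1 (act_deriv z)) !linear0.
rewrite act_mul act_l linearD /= !d_mul_l IH linearD /= act_mul act_l act_act.
by rewrite !act_sgn !addrA [in LHS](ACl (1 * 3 * 2 * 4)).
Qed.

(** For a derivation [f] of [g], the commutator of [D] with the action of [u] is the action of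
    [f u]; this accounts for the extra term when [D] passes through the recursion for [d]. It will
    be applied to the weight derivation. *)
Lemma d_deriv f D : is_deriv f D ->
  (forall x y, f (x ** y) = f x ** y + x ** f y) ->
  forall x, d (D x) = D (d x).
Proof.
move=> dD fM; have [DM Dl] := dD; elim/T_ind=> [|a x y IHx IHy||x u IH].
- by rewrite !linear0.
- by rewrite !linearP IHx IHy.
- by rewrite d1 (deriv1 dD) !linear0.
have comm : D (act u (sgn x)) = act u (D (sgn x)) + act (f u) (sgn x).
  apply: (deriv_commutator dD (act_deriv u) (act_deriv (f u))) => v.
  exact: fM.
rewrite DM Dl linearD /= !d_mul_l IH linearD /= DM Dl comm (deriv_sgn dD).
by rewrite addrACA.
Qed.

(* For a general word x, d (z * x) also has terms acting on z by one letter of x and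
   deleting it; for Lie elements of length at least 2 these cancel. *)
Definition primitive (x : T) := aug x = 0 /\
  (forall z, d (z * x) = d z * x + sgn z * d x + act (pr1 x) (sgn z)).

(** All that the sign computations need from [x] being of degree [p]. *)
Definition homog (p : nat) x :=
  sgn x = (-1) ^+ p *: x /\ (p != 1%N -> pr1 x = 0).

Lemma primitive_l u : primitive (l u).
Proof. by split=> // z; rewrite d_mul_l d_l mulr0 addr0 pr1_l. Qed.

Lemma act_lin x : linear (act^~ x).
Proof.
move=> a y z; elim/T_ind: x => [|b x x' IH IH'||x u IH].
- by rewrite !linear0 addr0.
- rewrite !(linearP (act _)) IH IH' /= !scalerDr !scalerA [a * b]mulrC.
  by rewrite addrACA.
- by rewrite !(deriv1 (act_deriv _)) scaler0 addr0.
rewrite !act_mul !act_l IH namul_linr linearP mulrDr mulrDl -!scalerAr -scalerAl.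
by rewrite scalerDr addrACA.
Qed.

Lemma primitive_lin a x y :
  primitive x -> primitive y -> primitive (a *: x + y).
Proof.
move=> [augx Px] [augy Py]; split.
  by rewrite linearP augx augy /= scaler0 addr0.
move=> z; rewrite [z * _]mulrDr -[z * (_ *: _)]scalerAr !(linearP d) /=.
rewrite Px Py (linearP pr1) /= act_lin.
rewrite !mulrDr -!scalerAr !scalerDr.
by rewrite !addrA [LHS](ACl (1 * 4 * 2 * 5 * 3 * 6)).
Qed.

Lemma d_mul x y : primitive y ->
  d (x * y) = d x * y + sgn x * d y + act (pr1 y) (sgn x).
Proof. by case. Qed.

(** The last summand collects the terms in which a letter [x] or [y] acts on [z]. Primitivity of a
    graded commutator amounts to their cancellation. *)
Lemma d_mul3 z x y : primitive x -> primitive y ->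
  d (z * (x * y)) = d z * (x * y) + sgn z * d (x * y)
    + (act (pr1 x) (sgn z) * y + act (pr1 y) (sgn z) * sgn x).
Proof.
move=> Px Py; rewrite mulrA !(d_mul _ Py) (d_mul _ Px) sgnM act_mul !mulrDl !mulrDr.
by rewrite !mulrA !addrA [LHS](ACl (1 * 2 * 4 * 6 * 3 * 5)).
Qed.

Lemma pr1_bracket s x y : primitive x -> primitive y -> pr1 (x * y - s *: (y * x)) = 0.
Proof.
move=> [ax _] [ay _].
by rewrite linearB linearZ /= !pr1M ax ay !scale0r addr0 scaler0 subr0.
Qed.

(** Both sides vanish unless [p = 1], and then the two signs have the same exponent. *)
Lemma homog_sign p q x (F : g -> T) : F 0 = 0 -> homog p x ->
  F (pr1 x) = (-1) ^+ (p * q) *: ((-1) ^+ q *: F (pr1 x)).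
Proof.
move=> F0 [_]; have [->|_ -> //] := eqVneq p 1%N.
  by rewrite mul1n scalerA -expr2 sqrr_sign scale1r.
by rewrite F0 !scaler0.
Qed.

(** The error terms of [x * y] and [y * x] cancel in the graded commutator. This is used twice: with
    [F u = act u (sgn z)] for primitivity, and with [F u = l (theta u)] for the homotopy
    identity. *)
Lemma bracket_cancel p q x y (F : g -> T) : F 0 = 0 -> homog p x -> homog q y ->
  F (pr1 x) * y + F (pr1 y) * sgn x =
  (-1) ^+ (p * q) *: (F (pr1 y) * x + F (pr1 x) * sgn y).
Proof.
move=> F0 hx hy; have hA := homog_sign q F0 hx; have hB := homog_sign p F0 hy.
rewrite mulnC in hB; rewrite hx.1 hy.1 -!scalerAr {1}hA {1}hB -!scalerAl scalerDr addrC.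
by rewrite !scalerA mulrCA -expr2 sqrr_sign mulr1.
Qed.

Lemma primitive_bracket p q x y : homog p x -> homog q y ->
  primitive x -> primitive y -> primitive (x * y - (-1) ^+ (p * q) *: (y * x)).
Proof.
move=> hx hy Px Py; split.
  by rewrite linearB linearZ /= !augM Px.1 Py.1 mulr0 scaler0 subr0.
move=> z; rewrite (pr1_bracket _ Px Py) act0 addr0.
set s := (-1) ^+ (p * q); set A := act (pr1 x) (sgn z); set B := act (pr1 y) (sgn z).
have key : A * y + B * sgn x = s *: (B * x + A * sgn y).
  exact: (bracket_cancel (F := act^~ (sgn z)) (act0 _)).
rewrite [z * _]mulrBr -[z * (_ *: _)]scalerAr !(linearB d) !(linearZZ d) /=.
rewrite (d_mul3 z Px Py) (d_mul3 z Py Px) -/A -/B !mulrBr -!scalerAr.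
rewrite key !(scalerDr s (_ + _)) opprD addrACA subrr addr0.
by rewrite scalerDr opprD addrACA.
Qed.

Lemma deriv_bracket f D s x y : is_deriv f D ->
  D (x * y - s *: (y * x)) =
  (D x * y - s *: (y * D x)) + (x * D y - s *: (D y * x)).
Proof.
move=> [DM _]; rewrite linearB linearZ /= !DM [D y * x + _]addrC.
by rewrite scalerDr opprD addrACA.
Qed.

Lemma primitive0 : primitive 0.
Proof. by split=> [|z]; rewrite ?mulr0 !linear0 // act0 mulr0 !addr0. Qed.

(** The graded commutator of two letters; they are odd, hence the plus sign. *)
Definition letter_bracket u v := l u * l v + l v * l u.

Lemma letter_bracket_linl v : linear (letter_bracket^~ v).
Proof.
move=> a x y; rewrite /letter_bracket linearP mulrDl mulrDr -scalerAl -scalerAr.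
by rewrite scalerDr addrACA.
Qed.

Lemma letter_bracket_linr u : linear (letter_bracket u).
Proof.
have C x y : letter_bracket x y = letter_bracket y x by rewrite /letter_bracket addrC.
by move=> a x y; rewrite !(C u) letter_bracket_linl.
Qed.

Lemma act_letter_bracket u v z :
  act z (letter_bracket u v) = letter_bracket (u ** z) v + letter_bracket u (v ** z).
Proof.
rewrite /letter_bracket linearD /= !act_mul !act_l !addrA.
by rewrite [LHS](ACl (1 * 4 * 2 * 3)).
Qed.

(** * The odd derivation [h] and the homotopy identity on brackets *)

Variables (h N : {linear T -> T}) (theta wt : {linear g -> g}).
Hypothesis hM : forall x y, h (x * y) = h x * y + sgn x * h y.
Hypothesis N_deriv : is_deriv wt N.
Hypothesis sgn_h_l : forall u, sgn (h (l u)) = h (l u).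
Hypothesis h_act_l : forall u y,
  h (l (u ** y)) = act y (h (l u)) - (l (theta y) * l u + l u * l (theta y)).

Lemma h1 : h 1 = 0.
Proof.
by have := hM 1 1; rewrite sgn1 !mulr1 mul1r -[LHS]addr0 => /addrI.
Qed.

Lemma h_sgn x : h (sgn x) = - sgn (h x).
Proof.
elim/T_ind: x => [|a x y IHx IHy||x u IH].
- by rewrite !linear0.
- by rewrite !(linearP sgn, linearP h) /= IHx IHy scalerN opprD.
- by rewrite sgn1 h1 !linear0.
rewrite sgnM sgn_l mulrN linearN /= !hM (linearD sgn) /= !sgnM IH sgn_l sgnK sgn_h_l.
by rewrite mulNr mulrN.
Qed.

(** The commutator of [h] with [act y] and the graded commutator with the letter [l (theta y)] are
    both odd derivations, so [h_act_l] propagates from letters to all of [T]. *)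
Lemma h_act y x :
  h (act y x) = act y (h x) - (l (theta y) * x - sgn x * l (theta y)).
Proof.
elim/T_ind: x => [|a x x' IH IH'||x u IH].
- by rewrite !linear0 mulr0 mul0r !subr0.
- rewrite !(linearP h, linearP (act y)) /= IH IH' (linearP sgn) mulrDr mulrDl.
  rewrite -scalerAr -scalerAl !scalerBr !opprB !addrA.
  by rewrite opprD !addrA [RHS](ACl (1 * 3 * 5 * 2 * 4 * 6)).
- by rewrite (deriv1 (act_deriv y)) h1 !linear0 sgn1 mulr1 mul1r subrr subr0.
rewrite act_mul act_l (linearD h) /= !hM IH h_act_l (linearD (act y)) /= !act_mul.
rewrite act_l sgnM sgn_l.
rewrite act_sgn.
rewrite !mulrDl !mulNr !mulrDr !mulrN !mulrDr !mulrDl !mulNr !mulrA.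
rewrite !opprD !opprK !addrA [LHS](ACl (1 * 5 * 4 * 6 * 2 * 8 * 3 * 7)) /=.
by rewrite addrK.
Qed.

(** If [d] were an odd derivation, [d h + h d] would be a derivation. The defect comes from the
    action of [pr1 y] in [d (x * y)]: moving [h] past it by [h_act] leaves the subtracted
    commutator. *)
Lemma homotopy_mul x y : primitive y -> primitive (h y) -> pr1 (h y) = 0 ->
  d (h (x * y)) + h (d (x * y)) =
  (d (h x) + h (d x)) * y + x * (d (h y) + h (d y))
  - (l (theta (pr1 y)) * sgn x - x * l (theta (pr1 y))).
Proof.
move=> Py Phy hy0; rewrite hM (d_mul x Py) !linearD /= (d_mul (h x) Py).
rewrite (d_mul (sgn x) Phy) hy0 act0 addr0 !hM h_act sgnK d_sgn h_sgn.
rewrite !mulNr !(linearN (act _)) /= !mulrDl !mulrDr !opprD !addrA.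
rewrite [LHS](ACl (1 * 6 * 5 * 9 * 11 * 12 * 2 * 8 * 3 * 10 * 7 * 4)) /=.
by rewrite !addrK.
Qed.

Lemma h_bracket p q x y : homog p x -> homog q y ->
  h (x * y - (-1) ^+ (p * q) *: (y * x)) =
  (h x * y - (-1) ^+ (p.+1 * q) *: (y * h x))
  + (-1) ^+ p *: (x * h y - (-1) ^+ (p * q.+1) *: (h y * x)).
Proof.
move=> [sx _] [sy _]; rewrite linearB linearZ /= !hM sx sy -!scalerAl.
rewrite mulSn mulnS !exprD; set P := _ ^+ p; set Q := _ ^+ q; set S := _ ^+ _.
have PP : P * P = 1 by rewrite -expr2 sqrr_sign.
rewrite scalerDr scalerBr !scalerA mulrA PP mul1r [S * Q]mulrC opprD !addrA.
by rewrite [LHS](ACl (1 * 4 * 2 * 3)).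
Qed.

Definition homotopic x := d (h x) + h (d x) = N x - l (theta (pr1 x)).

Lemma homotopy_bracket p q x y : homog p x -> homog q y ->
  primitive x -> primitive y -> primitive (h x) -> primitive (h y) ->
  pr1 (h x) = 0 -> pr1 (h y) = 0 -> homotopic x -> homotopic y ->
  homotopic (x * y - (-1) ^+ (p * q) *: (y * x)).
Proof.
move=> hx hy Px Py Phx Phy hx0 hy0 Hx Hy.
(* One half of the commutator in [homotopy_mul] cancels against [u * l (theta (pr1 v))], which
   leaves an error of the shape that [bracket_cancel] handles. *)
have Hmul u v : primitive v -> primitive (h v) -> pr1 (h v) = 0 ->
    homotopic u -> homotopic v -> d (h (u * v)) + h (d (u * v)) =
    N (u * v) - (l (theta (pr1 u)) * v + l (theta (pr1 v)) * sgn u).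
  move=> Pv Phv hv0 Hu Hv; rewrite homotopy_mul // Hu Hv mulrBl mulrBr N_deriv.1.
  rewrite !opprD !opprK !addrA [LHS](ACl (1 * 3 * 2 * 5 * 4 * 6)) /=.
  by rewrite subrK.
rewrite /homotopic (pr1_bracket _ Px Py) !linear0 addr0.
rewrite !(linearB h, linearB d, linearB N) !(linearZZ h, linearZZ d, linearZZ N).
rewrite addrACA -opprD -scalerDr.
rewrite !Hmul // (bracket_cancel (F := fun u => l (theta u)) _ hx hy) ?linear0 //.
by rewrite scalerBr opprB addrA subrK.
Qed.

Lemma homotopic_l u : d (h (l u)) = N (l u) - l (theta u) -> homotopic (l u).
Proof. by rewrite /homotopic d_l linear0 addr0 pr1_l. Qed.

Lemma homotopic0 : homotopic 0.
Proof. by rewrite /homotopic !linear0 addr0. Qed.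

Lemma homotopic_lin a x y : homotopic x -> homotopic y -> homotopic (a *: x + y).
Proof.
rewrite /homotopic !(linearP h, linearP d, linearP N, linearP pr1) /= => Hx Hy.
rewrite !(linearP h, linearP d, linearP theta, linearP l) /= addrACA -scalerDr Hx Hy.
by rewrite scalerBr opprD addrACA.
Qed.

Lemma d_h_act x y : d (h (l x)) = l (wt x) - l (theta x) ->
  x ** theta y = x ** wt y ->
  wt (x ** y) = wt x ** y + x ** wt y ->
  theta (x ** y) = theta x ** y - theta y ** x ->
  d (h (l (x ** y))) = l (wt (x ** y)) - l (theta (x ** y)).
Proof.
move=> dhx th_wt -> ->; rewrite h_act_l linearB /= d_act dhx !linearB /= !act_l.
rewrite linearD /= !d_mul_l !d_l !mul0r !add0r !sgn_l !linearN /= !act_l th_wt.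
by rewrite opprB (linearD l) addrACA.
Qed.

(** * The homotopy identity on letters, by induction from the generators of [g] *)

Variables (W : lmodType k) (gen : {linear W -> g}).
Hypothesis g_ind : forall A : g -> Prop,
  A 0 -> (forall a x y, A x -> A y -> A (a *: x + y)) ->
  (forall v, A (gen v)) -> (forall x y, A x -> A y -> A (x ** y)) ->
  forall x, A x.
Hypotheses (wt_gen : forall v, wt (gen v) = gen v)
  (wtM : forall x y, wt (x ** y) = wt x ** y + x ** wt y).
Hypotheses (theta_gen : forall v, theta (gen v) = gen v)
  (thetaM : forall x y, theta (x ** y) = theta x ** y - theta y ** x).
Hypothesis h_gen : forall v, h (l (gen v)) = 0.

(** By the Leibniz identity [x ** (a ** b)] is antisymmetric in [a] and [b]. To the right of [x],
    therefore, the rule for [theta] becomes the derivation rule of [wt]. *)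
Lemma namul_theta x y : x ** theta y = x ** wt y.
Proof.
elim/g_ind: y x => [|a y z IHy IHz|v|y z IHy IHz] x.
- by rewrite !linear0.
- by rewrite !linearP /= IHy IHz.
- by rewrite theta_gen wt_gen.
by rewrite thetaM wtM linearB linearD /= !right_leibniz !IHy !IHz !opprB.
Qed.

Lemma d_h_letter u : d (h (l u)) = l (wt u) - l (theta u).
Proof.
elim/g_ind: u => [|a x y IHx IHy|v|x y IHx IHy].
- by rewrite !linear0 addr0.
- rewrite !(linearP l, linearP h, linearP d, linearP wt, linearP theta) /= IHx IHy.
  by rewrite scalerBr opprD addrACA.
- by rewrite h_gen linear0 wt_gen theta_gen subrr.
by apply: d_h_act => //; apply: namul_theta.
Qed.

(** * From letters to the graded Lie subalgebra [L] *)

Variables (deg : int -> subspace T) (L : subspace T).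
Hypothesis L_ind : forall A : T -> Prop, (forall u, A (l u)) ->
  A 0 -> (forall a x y, A x -> A y -> A (a *: x + y)) ->
  (forall (p q : nat) x y, deg p x -> deg q y -> L x -> L y -> A x -> A y ->
     A (x * y - (-1) ^+ (p * q) *: (y * x))) ->
  forall x, L x -> A x.
Hypothesis L_l : forall u, L (l u).
Hypothesis L_bracket : forall (p q : nat) x y,
  deg p x -> deg q y -> L x -> L y -> L (x * y - (-1) ^+ (p * q) *: (y * x)).
Hypothesis deg_l : forall u, deg 1 (l u).
Hypothesis deg_sgn : forall (p : nat) x, deg p x -> sgn x = (-1) ^+ p *: x.
Hypothesis deg_pr1 : forall n x, n != 1 -> deg n x -> pr1 x = 0.
Hypothesis deg_act : forall y n x, deg n x -> deg n (act y x).
Hypothesis deg_N : forall n x, deg n x -> deg n (N x).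
Hypothesis deg_h : forall n x, deg n x -> deg (n + 1) (h x).

Let deg_homog (p : nat) x : deg p x -> homog p x.
Proof. by move=> px; split; [apply: deg_sgn | move=> p1; apply: deg_pr1 px]. Qed.

Lemma L_deriv f D : is_deriv f D -> (forall n x, deg n x -> deg n (D x)) ->
  forall x, L x -> L (D x).
Proof.
move=> dD degD; have [_ Dl] := dD => x Lx.
elim/L_ind: x / Lx => [u||a x y Lx Ly|p q x y px qy Lx Ly LDx LDy].
- by rewrite Dl.
- by rewrite linear0; apply: subspace0.
- by rewrite linearP; apply: subspace_lin.
rewrite (deriv_bracket _ _ _ dD) -[X in X + _]scale1r; apply: subspace_lin.
  by apply: L_bracket => //; apply: degD.
by apply: L_bracket => //; apply: degD.
Qed.

Lemma L_h_letter u : L (h (l u)).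
Proof.
elim/g_ind: u => [|a x y IHx IHy|v|x y IHx IHy].
- by rewrite !linear0; apply: subspace0.
- by rewrite !(linearP l, linearP h); apply: subspace_lin.
- by rewrite h_gen; apply: subspace0.
rewrite h_act_l addrC -scaleN1r; apply: subspace_lin; last first.
  by apply: L_deriv (act_deriv y) _ _ _ => //; apply: deg_act.
have := @L_bracket 1 1 _ _ (deg_l x) (deg_l (theta y)) (L_l x) (L_l (theta y)).
by rewrite muln1 expr1 scaleN1r opprK addrC.
Qed.

Lemma L_h x : L x -> L (h x).
Proof.
move=> Lx; elim/L_ind: x / Lx => [u||a y z Ly Lz|p q y z py qz Ly Lz Lhy Lhz].
- exact: L_h_letter.
- by rewrite linear0; apply: subspace0.
- by rewrite linearP; apply: subspace_lin.
have [hy hz] := (deg_homog py, deg_homog qz).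
rewrite (h_bracket hy hz) addrC; apply: subspace_lin.
  by apply: L_bracket => //; rewrite -addn1 PoszD; apply: deg_h.
by apply: L_bracket => //; rewrite -addn1 PoszD; apply: deg_h.
Qed.

Lemma L_primitive x : L x -> primitive x.
Proof.
move=> Lx; elim/L_ind: x / Lx => [u||a y z Py Pz|p q y z py qz _ _ Py Pz].
- exact: primitive_l.
- exact: primitive0.
- exact: primitive_lin.
by apply: primitive_bracket => //; apply: deg_homog.
Qed.

(** As [x] may be inhomogeneous, degrees alone do not suffice. On a letter [h] lands in degree 2,
    and [h] of a bracket is a combination of brackets of primitive elements, which [pr1] kills. *)
Lemma pr1_h x : L x -> pr1 (h x) = 0.
Proof.
move=> Lx; elim/L_ind: x / Lx => [u||a y z Hy Hz|p q y z py qz Ly Lz Hy Hz].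
- by apply: (@deg_pr1 (1 + 1)) => //; apply: deg_h.
- by rewrite !linear0.
- by rewrite !linearP Hy Hz scaler0 addr0.
rewrite (h_bracket (deg_homog py) (deg_homog qz)) (linearD pr1) (linearZZ pr1).
by rewrite !pr1_bracket ?scaler0 ?addr0 //; apply: L_primitive => //; apply: L_h.
Qed.

Lemma L_homotopic x : L x -> homotopic x.
Proof.
move=> Lx; elim/L_ind: x / Lx => [u||a y z Hy Hz|p q y z py qz Ly Lz Hy Hz].
- by apply: homotopic_l; rewrite d_h_letter N_deriv.2.
- exact: homotopic0.
- exact: homotopic_lin.
apply: homotopy_bracket => //; by [apply: deg_homog | apply: L_primitive |
  apply: pr1_h | apply/L_primitive/L_h].
Qed.

(** Generators have weight 1, and weights add under the products of [g] and of [T]. The unit of [T],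
    of weight 0, is not reached from letters by brackets. *)
Lemma L_weighted x : L x -> weighted N x.
Proof.
have wl u : weighted N (l u).
  have : weighted wt u.
    elim/g_ind: u => [|a y z|v|y z]; first exact: subspace0.
    - exact: subspace_lin.
    - by apply: span_incl; exists 1%N; rewrite ?wt_gen ?scale1r.
    by apply: weighted_mul => //; [exact: namul_linl | exact: namul_linr].
  elim=> [|a v u' [w w0 wv] _ IH]; first by rewrite linear0; apply: subspace0.
  rewrite linearP; apply: subspace_lin IH; apply: span_incl; exists w => //.
  by rewrite N_deriv.2 wv linearZ.
have wM : forall y z, weighted N y -> weighted N z -> weighted N (y * z).
  apply: weighted_mul => [y a u v|y a u v|]; last exact: N_deriv.1.
    by rewrite mulrDl scalerAl.
  by rewrite mulrDr scalerAr.
move=> Lx; elim/L_ind: x / Lx => [//||a y z Hy Hz|p q y z py qz Ly Lz Hy Hz].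
- exact: subspace0.
- exact: subspace_lin.
by rewrite addrC -scaleNr; apply: subspace_lin; apply: wM.
Qed.

(** Outside degree 1 the term with [pr1] vanishes, so the homotopy identity on a cycle reads
    [d (h x) = N x]. Then [weighted_descent], with cycles as [Z] and boundaries as [B], removes
    [N]. *)
Lemma L_exact n x : (forall m, (0 < m)%N -> m%:R != 0 :> k) -> n != 1 ->
  L x -> deg n x -> d x = 0 ->
  exists2 y, subcap L (deg (n + 1)) y & x = d y.
Proof.
move=> char0 n1 Lx nx dx.
have B0 : exists2 y, subcap L (deg (n + 1)) y & 0 = d y.
  by exists 0; [exact: subspace0 | rewrite linear0].
have Blin a u v :
    (exists2 y, subcap L (deg (n + 1)) y & u = d y) ->
    (exists2 y, subcap L (deg (n + 1)) y & v = d y) ->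
    exists2 y, subcap L (deg (n + 1)) y & a *: u + v = d y.
  move=> [y Cy ->] [z Cz ->]; exists (a *: y + z); first exact: subspace_lin.
  by rewrite linearP.
pose B := Subspace B0 Blin.
pose Z := @cycles k T d (fun m => subcap L (deg m)) n.
apply: (@weighted_descent _ _ N Z B char0 _ _ x (L_weighted Lx)) => //.
  move=> y [[Ly ny] dy]; split; last by rewrite (d_deriv N_deriv wtM) dy linear0.
  by split; [exact: L_deriv N_deriv deg_N _ Ly | exact: deg_N].
move=> y [[Ly ny] dy]; exists (h y); first by split; [exact: L_h | exact: deg_h].
have := L_homotopic Ly; rewrite /homotopic dy (deg_pr1 n1 ny) !linear0 addr0.
by rewrite addr0.
Qed.

Lemma pr1_act y x : pr1 1 = 0 -> pr1 (act y x) = pr1 x ** y.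
Proof.
move=> pr11; elim/T_ind: x => [|a x x' IH IH'||x u IH].
- by rewrite !linear0 namul0l.
- by rewrite !linearP /= IH IH' namul_linl.
- by rewrite (deriv1 (act_deriv y)) pr11 linear0 namul0l.
rewrite act_mul act_l linearD /= !pr1M !aug_l (aug_deriv _ (act_deriv y)) !pr1_l.
rewrite !scale0r !addr0 add0r -[aug x *: u]addr0 namul_linl namul0l addr0 //.
Qed.

(** Only brackets of two letters have a boundary with a letter component, and there it is minus a
    symmetrised product, which [F] kills. *)
Lemma pr1_d_bracket (Q : lmodType k) (F : {linear g -> Q}) :
  pr1 1 = 0 -> (forall u v, F (u ** v) + F (v ** u) = 0) ->
  forall x, L x -> F (pr1 (d x)) = 0.
Proof.
move=> pr11 F0 x Lx; elim/L_ind: x / Lx => [u||a y z Hy Hz|p q y z py qz Ly Lz _ _].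
- by rewrite d_l !linear0.
- by rewrite !linear0.
- by rewrite !linearP /= Hy Hz scaler0 addr0.
have [Py Pz] := (L_primitive Ly, L_primitive Lz).
(* [u], [v] and all values of [d] have zero augmentation, so only the action term of [d (u * v)] has
   a letter component. *)
have Fd (m n : nat) u v : deg m u -> primitive u -> primitive v ->
    F (pr1 (d (u * v))) = (-1) ^+ m *: F (pr1 u ** pr1 v).
  move=> mu [au _] Pv; rewrite (d_mul _ Pv) (deg_sgn mu) -scalerAl (linearZZ (act _)).
  rewrite !(linearD pr1) !(linearZZ pr1) !pr1M !aug_d au Pv.1 pr1_act //.
  by rewrite !scale0r !addr0 scaler0 !add0r (linearZZ F).
rewrite (linearB d) (linearZZ d) (linearB pr1) (linearZZ pr1) (linearB F) (linearZZ F).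
rewrite (Fd p q y z) // (Fd q p z y) //.
have [p1|p1] := eqVneq p 1%N; last first.
  have -> : pr1 y = 0 by apply: deg_pr1 py.
  by rewrite namul0l namul0r !linear0 addr0.
have [q1|q1] := eqVneq q 1%N; last first.
  have -> : pr1 z = 0 by apply: deg_pr1 qz.
  by rewrite namul0l namul0r !linear0 addr0.
by rewrite p1 q1 muln1 expr1 !scaleN1r opprK -opprD F0 oppr0.
Qed.

End AbstractLeibnizComplex.

(** * Existence of [N], [theta] and [eta] from the universal property *)

Section Extension.
Variables (k : fieldType) (g : leibnizType k) (T : lmodType k).
Variables (act : g -> {linear T -> T}) (br : g -> g -> T).
Hypothesis act_lin : forall z, linear (act^~ z).
Hypothesis act_act : forall y z x, act z (act y x) = act y (act z x) + act (y ** z) x.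
Hypotheses (br_linl : forall z, linear (br^~ z)) (br_linr : forall z, linear (br z)).
Hypothesis act_br : forall x y z, act z (br x y) = br (x ** z) y + br x (y ** z).

Let E : lmodType k := (g * g * g * T)%type.

(* A product on quadruples (x, N x, theta x, eta x): a morphism from g to this Leibniz
   algebra with first component the identity is a triple (N, theta, eta) satisfying
   the recursions in the header. *)
Definition ext_mul (u v : E) : E :=
  let: (x, n, a, p) := u in let: (y, m, b, q) := v in
  (x ** y, n ** y + x ** m, a ** y - b ** x, act y p - br x b).

Fact ext_mul_linl z : linear (ext_mul^~ z).
Proof.
case: z => [[[y m] b] q] c [[[x n] a] p] [[[x' n'] a'] p'].
congr (_, _, _, _) => /=.
- exact: namul_linl.
- by rewrite !namul_linl scalerDr addrACA.
- by rewrite namul_linl namul_linr scalerBr opprD addrACA.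
- by rewrite (linearP (act y)) br_linl /= scalerBr opprD addrACA.
Qed.

Fact ext_mul_linr z : linear (ext_mul z).
Proof.
case: z => [[[x n] a] p] c [[[y m] b] q] [[[y' m'] b'] q'].
congr (_, _, _, _) => /=.
- exact: namul_linr.
- by rewrite !namul_linr scalerDr addrACA.
- by rewrite namul_linl namul_linr scalerBr opprD addrACA.
- by rewrite act_lin br_linr /= scalerBr opprD addrACA.
Qed.

Let mulDl (x y z : g) : (x + y) ** z = x ** z + y ** z.
Proof. by have := namul_linl z 1 x y; rewrite !scale1r. Qed.
Let mulDr (x y z : g) : z ** (x + y) = z ** x + z ** y.
Proof. exact: linearD. Qed.
Let mulBl (x y z : g) : (x - y) ** z = x ** z - y ** z.
Proof. by rewrite -[- y]scaleN1r addrC namul_linl scaleN1r addrC. Qed.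
Let brBr (x y z : g) : br z (x - y) = br z x - br z y.
Proof. by rewrite -[- y]scaleN1r addrC br_linr scaleN1r addrC. Qed.

(** The first three components follow from the Leibniz identity of [g] alone; the last one also
    needs [act_act] and [act_br]. *)
Fact ext_leibniz (x y z : E) :
  ext_mul x (ext_mul y z) = ext_mul (ext_mul x y) z - ext_mul (ext_mul x z) y.
Proof.
case: x y z => [[[x n] a] p] [[[y m] b] q] [[[z o] c] r].
congr (_, _, _, _); rewrite /=.
- exact: right_leibniz.
- rewrite !mulDr !mulDl !right_leibniz !opprD.
  by rewrite !addrA [LHS](ACl (1 * 3 * 5 * 2 * 6 * 4)).
- rewrite !mulBl !right_leibniz !opprB !addrA.
  by rewrite [RHS](ACl (1 * 8 * 3 * 6 * 4 * 7 * 2 * 5)) /= !subrK.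
- rewrite !brBr !(linearB (act _)) /= !act_br [act z (act y p)]act_act.
  rewrite !opprB ?opprD ?opprK !addrA.
  by rewrite [RHS](ACl (2 * 8 * 4 * 3 * 6 * 5 * 7 * 1 * 9)) /= addrK !subrK.
Qed.

Definition ext_na : naAlgType k :=
  HB.pack E (isNAAlgebra.Build k E ext_mul_linl ext_mul_linr).

Definition ext : leibnizType k :=
  HB.pack ext_na (isLeibniz.Build k ext_na ext_leibniz).

Lemma ext_diag_linear (V : lmodType k) (e : {linear V -> g}) :
  linear (fun v => (e v, e v, e v, 0) : ext).
Proof.
move=> a u v; congr (_, _, _, _); rewrite /= ?linearP //.
by rewrite scaler0 addr0.
Qed.

Variables (V : lmodType k) (gen : {linear V -> g}).
Hypothesis g_ind : forall A : g -> Prop,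
  A 0 -> (forall a x y, A x -> A y -> A (a *: x + y)) ->
  (forall v, A (gen v)) -> (forall x y, A x -> A y -> A (x ** y)) ->
  forall x, A x.
Hypothesis g_univ : forall (A : leibnizType k) (f : {linear V -> A}),
  exists phi : {linear g -> A},
  [/\ forall x y, phi (x ** y) = phi x ** phi y,
      forall v, phi (gen v) = f v
    & forall psi : {linear g -> A},
        (forall x y, psi (x ** y) = psi x ** psi y) ->
        (forall v, psi (gen v) = f v) -> psi =1 phi].

Lemma homotopy_operators_exist : exists (N theta : {linear g -> g}) (eta : {linear g -> T}),
  [/\ (forall v, N (gen v) = gen v) /\
      (forall x y, N (x ** y) = N x ** y + x ** N y),
      (forall v, theta (gen v) = gen v) /\
      (forall x y, theta (x ** y) = theta x ** y - theta y ** x) &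
      (forall v, eta (gen v) = 0) /\
      (forall x y, eta (x ** y) = act y (eta x) - br x (theta y))].
Proof.
pose A := ext.
(* The initial values: the weight and [theta] fix generators, and [eta] kills them. *)
pose f v : A := (gen v, gen v, gen v, 0).
pose fL : {linear V -> A} := HB.pack f (GRing.isLinear.Build k V A _ f
  (ext_diag_linear gen)).
have [phi [phiM phi_gen _]] := g_univ fL.
pose p1 x := (phi x).1.1.1; pose p2 x := (phi x).1.1.2; pose p3 x := (phi x).1.2.
pose p4 x := (phi x).2.
(* The first component of [phi] is multiplicative and fixes the generators. Only after it is known
   to be the identity do the other components satisfy recursions over [g]. *)
have p1_id x : p1 x = x.
  elim/g_ind: x => [|a x y IHx IHy|v|x y IHx IHy].
  - by rewrite /p1 linear0.
  - by rewrite -[in RHS]IHx -[in RHS]IHy /p1 linearP.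
  - by rewrite /p1 phi_gen.
  rewrite -[in RHS]IHx -[in RHS]IHy /p1 phiM.
  by case: (phi x) (phi y) => [[[? ?] ?] ?] [[[? ?] ?] ?].
have l2 : linear p2 by move=> a x y; rewrite /p2 linearP.
have l3 : linear p3 by move=> a x y; rewrite /p3 linearP.
have l4 : linear p4 by move=> a x y; rewrite /p4 linearP.
have pM x y : phi (x ** y) = ext_mul (p1 x, p2 x, p3 x, p4 x) (p1 y, p2 y, p3 y, p4 y).
  rewrite phiM /p1 /p2 /p3 /p4.
  by case: (phi x) (phi y) => [[[? ?] ?] ?] [[[? ?] ?] ?].
pose N : {linear g -> g} := HB.pack p2 (GRing.isLinear.Build k g g _ p2 l2).
pose theta : {linear g -> g} := HB.pack p3 (GRing.isLinear.Build k g g _ p3 l3).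
pose eta : {linear g -> T} := HB.pack p4 (GRing.isLinear.Build k g T _ p4 l4).
exists N, theta, eta; split; split=> [v|x y] /=; rewrite ?/p2 ?/p3 ?/p4 ?phi_gen //.
- by rewrite pM /= !p1_id.
- by rewrite pM /= !p1_id.
- by rewrite pM /= !p1_id.
Qed.

(** Applied with [D] the degree 2 part, this shows that the homotopy raises degree by 1. *)
Lemma eta_in (D : subspace T) (theta : {linear g -> g}) (eta : {linear g -> T}) :
  (forall y x, D x -> D (act y x)) -> (forall x y, D (br x y)) ->
  (forall v, eta (gen v) = 0) ->
  (forall x y, eta (x ** y) = act y (eta x) - br x (theta y)) ->
  forall u, D (eta u).
Proof.
move=> Dact Dbr etagen etaM; elim/g_ind=> [|a x y Hx Hy|v|x y Hx Hy].
- by rewrite linear0; apply: subspace0.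
- by rewrite linearP; apply: subspace_lin.
- by rewrite etagen; apply: subspace0.
by rewrite etaM addrC -scaleN1r; apply: subspace_lin; last exact: Dact.
Qed.

End Extension.

(** * Induction on the free Leibniz algebra *)

Section FreeLeibniz.
Variables (k : fieldType) (V : lmodType k).
Local Notation g := (freeLeib V).

Fact freeLeib_gen_linear : linear (@freeLeib_gen k V).
Proof.
move=> a u v; apply/eqP; rewrite -subr_eq0 /freeLeib_gen /pword.
rewrite -linearP -linearB; apply/eqP/pres_rel; exact: freeLeib_lin.
Qed.
HB.instance Definition _ :=
  GRing.isLinear.Build k V g _ (@freeLeib_gen k V) freeLeib_gen_linear.

Lemma freeLeib_ind (A : g -> Prop) :
  A 0 -> (forall a x y, A x -> A y -> A (a *: x + y)) ->
  (forall v, A (freeLeib_gen v)) -> (forall x y, A x -> A y -> A (x ** y)) ->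
  forall x, A x.
Proof.
move=> A0 Alin Agen Amul; elim/pres_ind=> // a t u; apply: Alin.
elim: t => [v|s As t At]; first exact: Agen.
by rewrite -pwordM; apply: Amul.
Qed.

End FreeLeibniz.

(** * Degree one *)

Section LeibnizKernel.
Variables (k : fieldType) (g : leibnizType k).

(** The Leibniz kernel. It is spanned by symmetrised products rather than squares because these are,
    up to sign, the boundaries of brackets of letters. *)
Definition leib_ker : subspace g :=
  subspan (fun u => exists x y : g, u = x ** y + y ** x).

Lemma leib_ker_sym x y : leib_ker (x ** y + y ** x).
Proof. by apply: span_incl; exists x, y. Qed.

(** [x ** (a ** b)] is antisymmetric in [a] and [b]. *)
Lemma namul_leib_ker x u : leib_ker u -> x ** u = 0.
Proof.
elim=> [|a y z [y1 [y2 ->]] _ IH]; first exact: namul0r.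
by rewrite namul_linr IH addr0 linearD /= !right_leibniz addrC subrKA subrr scaler0.
Qed.

(** Right multiplication by [x] is a derivation, so it sends a symmetrised product to a sum of two
    such. *)
Lemma leib_ker_namul x u : leib_ker u -> leib_ker (u ** x).
Proof.
elim=> [|a y z [y1 [y2 ->]] _ IH]; first by rewrite namul0l; apply: subspace0.
rewrite namul_linl; apply: subspace_lin IH.
have -> : (y1 ** y2 + y2 ** y1) ** x = 1 *: (y1 ** (y2 ** x) + (y2 ** x) ** y1)
    + (1 *: ((y1 ** x) ** y2 + y2 ** (y1 ** x)) + 0).
  have := namul_linl x 1 (y1 ** y2) (y2 ** y1); rewrite !scale1r addr0 => ->.
  rewrite !right_leibniz !addrA.
  by rewrite [RHS](ACl (1 * 5 * 2 * 4 * 3 * 6)) /= addrK subrK.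
do 2! [apply: subspace_lin; first exact: leib_ker_sym].
exact: subspace0.
Qed.

Lemma leib_ker_square x : 2%:R != 0 :> k -> leib_ker (x ** x).
Proof.
move=> two0; have -> : x ** x = 2%:R^-1 *: (x ** x + x ** x) + 0.
  by rewrite addr0 -mulr2n -scaler_nat scalerA mulVf ?scale1r.
by apply: subspace_lin; [exact: leib_ker_sym | exact: subspace0].
Qed.

(** Expanding [x ** (y ** z)] by the Leibniz identity leaves two symmetrised products and,
    subtracted, a third one multiplied by [y]. *)
Lemma leib_ker_jacobi x y z :
  leib_ker (x ** (y ** z) + y ** (z ** x) + z ** (x ** y)).
Proof.
have -> : x ** (y ** z) + y ** (z ** x) + z ** (x ** y) =
    (-1) *: ((x ** z + z ** x) ** y) +
    (1 *: ((x ** y) ** z + z ** (x ** y)) +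
     (1 *: (y ** (z ** x) + (z ** x) ** y) + 0)).
  have := namul_linl y 1 (x ** z) (z ** x); rewrite !scale1r scaleN1r addr0 => ->.
  rewrite [x ** (y ** z)]right_leibniz opprD !addrA.
  by rewrite [RHS](ACl (3 * 1 * 5 * 4 * 6 * 2)) /= addrK.
apply: subspace_lin; first exact/leib_ker_namul/leib_ker_sym.
do 2! [apply: subspace_lin; first exact: leib_ker_sym].
exact: subspace0.
Qed.

End LeibnizKernel.

(** * The projection from the free Leibniz algebra to the free Lie algebra and its kernel *)

Lemma lie_antisym (k : fieldType) (A : lieType k) (x y : A) : x ** y + y ** x = 0.
Proof.
have DL (u v w : A) : (u + v) ** w = u ** w + v ** w.
  by have := namul_linl w 1 u v; rewrite !scale1r.
have := lie_alt (x + y); rewrite DL !linearD /= !lie_alt add0r addr0 //.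
Qed.

Lemma lie_right_leibniz (k : fieldType) (A : lieType k) (x y z : A) :
  x ** (y ** z) = (x ** y) ** z - (x ** z) ** y.
Proof.
have S (u v : A) : u ** v = - (v ** u) by apply/eqP; rewrite -addr_eq0 lie_antisym.
have N (u v : A) : (- u) ** v = - (u ** v).
  by have := namul_linl v (-1) u 0; rewrite !scaleN1r namul0l !addr0.
have := lie_jacobi x y z; rewrite (S z (x ** y)) (S y (z ** x)) (S z x) N opprK.
by move/eqP; rewrite subr_eq0 => /eqP <-; rewrite addrK.
Qed.

Section FreeLieQuotient.
Variables (k : fieldType) (V : lmodType k).
Local Notation LeibI := (ideal (@Node V) (@freeLeib_rel k V)).
Local Notation LieI := (ideal (@Node V) (@freeLie_rel k V)).
Local Notation "x <.> y" := (malg_op (@Node V) x y)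
  (at level 40, left associativity).

Lemma freeLie_mul (x y : {malg k[magma V]}) :
  @namul k (freeLie V) (lpi LieI x) (lpi LieI y) = lpi LieI (x <.> y).
Proof. exact: pres_namulE. Qed.

Lemma freeLeib_mul (x y : {malg k[magma V]}) :
  @namul k (freeLeib V) (lpi LeibI x) (lpi LeibI y) = lpi LeibI (x <.> y).
Proof. exact: pres_namulE. Qed.

(** Both free algebras are quotients of the same magma algebra, so this inclusion of ideals induces
    the projection. *)
Lemma freeLeib_sub_freeLie x : LeibI x -> LieI x.
Proof.
elim=> [r [a u v|a b c]||a y z _ IHy _ IHz|y z _ IH|y z _ IH].
- exact/ideal_rel/freeLie_lin.
- apply/lpi_eq; rewrite linearB /= -!freeLie_mul.
  exact: (@lie_right_leibniz k (freeLie V) (lpi LieI a) (lpi LieI b) (lpi LieI c)).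
- exact: ideal_zero.
- exact: ideal_lin.
- exact: ideal_mull.
- exact: ideal_mulr.
Qed.

Fact lie_of_leib_subproof x : LeibI x -> lpi LieI x = 0.
Proof.
by move=> /freeLeib_sub_freeLie Lx; rewrite -(lpi0 LieI); apply/lpi_eq; rewrite subr0.
Qed.

Definition lie_of_leib : freeLeib V -> freeLie V := lquot_lift lie_of_leib_subproof.
HB.instance Definition _ := GRing.Linear.on lie_of_leib.

Lemma lie_of_leibE x : lie_of_leib (lpi LeibI x) = lpi LieI x.
Proof. exact: lquot_liftE. Qed.

Lemma lie_of_leib_surj y : exists x, lie_of_leib x = y.
Proof. by have [x ->] := lpi_surj y; exists (lpi LeibI x); rewrite lie_of_leibE. Qed.

Lemma lie_of_leibM x y : lie_of_leib (x ** y) = lie_of_leib x ** lie_of_leib y.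
Proof.
have [a ->] := lpi_surj x; have [b ->] := lpi_surj y.
by rewrite freeLeib_mul !lie_of_leibE freeLie_mul.
Qed.

Lemma lie_of_leib_antisym x y : lie_of_leib (x ** y) + lie_of_leib (y ** x) = 0.
Proof. by rewrite !lie_of_leibM; exact: lie_antisym. Qed.

(** The Leibniz kernel is a two-sided ideal that contains squares and Jacobi sums, hence the image
    of every Lie relation. Halving a doubled square needs 2 to be invertible. *)
Lemma lie_of_leib_ker x :
  2%:R != 0 :> k -> lie_of_leib x = 0 -> leib_ker (freeLeib V) x.
Proof.
have [y ->] := lpi_surj x; rewrite lie_of_leibE -(lpi0 LieI) => two0 /lpi_eq.
rewrite subr0; elim=> {x y} [r [a u v|y|a b c]||a y z _ IHy _ IHz|y z _ IH|y z _ IH].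
- by rewrite pres_rel; [exact: subspace0 | exact: freeLeib_lin].
- by rewrite -freeLeib_mul; apply: leib_ker_square.
- by rewrite !linearD /= -!freeLeib_mul; apply: leib_ker_jacobi.
- by rewrite linear0; apply: subspace0.
- by rewrite linearP; apply: subspace_lin.
- by rewrite -freeLeib_mul (namul_leib_ker _ IH); apply: subspace0.
- by rewrite -freeLeib_mul; apply: leib_ker_namul.
Qed.

End FreeLieQuotient.

(** * The abstract results applied to the tensor algebra *)

Section PirashviliComplex.
Variables (k : fieldType) (g : leibnizType k).
Local Notation T := (tensor g).
Local Notation sgn := (tscale (-1)).

Lemma act_is_deriv (y : g) :
  is_deriv (@letter k g) (fun x => x ** y) (act y).
Proof. by split=> [a b|u]; [exact: lderM | exact: lder_letter]. Qed.

Lemma sgn_letter (u : g) : sgn (letter u) = - letter u.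
Proof. by rewrite tscale_letter scaleN1r. Qed.

Lemma gLie_ind (A : T -> Prop) : (forall u, A (letter u)) -> A 0 ->
  (forall a x y, A x -> A y -> A (a *: x + y)) ->
  (forall (p q : nat) x y, tensor_deg g p x -> tensor_deg g q y ->
     gLie g x -> gLie g y -> A x -> A y -> A (x * y - (-1) ^+ (p * q) *: (y * x))) ->
  forall x, gLie g x -> A x.
Proof.
move=> Al A0 Alin Abr x; elim=> // [a y z _ Ay _ Az|p q y z py qz Ly Ay Lz Az].
  exact: Alin.
exact: Abr.
Qed.

Lemma act_deg (y : g) n x : tensor_deg g n x -> tensor_deg g n (act y x).
Proof. exact: lder_deg. Qed.

Lemma letter_bracket_deg (x y : g) :
  tensor_deg g 2 (letter_bracket (@letter k g) x y).
Proof.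
have H (u v : g) : tensor_deg g 2 (letter u * letter v).
  exact: (tensor_degM (tensor_deg_letter u) (tensor_deg_letter v)).
have -> : letter_bracket (@letter k g) x y =
    1 *: (letter x * letter y) + letter y * letter x.
  by rewrite scale1r.
exact: (subspace_lin 1 (H x y) (H y x)).
Qed.

Lemma pr1_1 : pr1 (1 : T) = 0.
Proof. by rewrite -tens_nil pr1E. Qed.

Lemma pr1_dLeib_gLie (Q : lmodType k) (F : {linear g -> Q}) :
  (forall u v, F (u ** v) + F (v ** u) = 0) ->
  forall x, gLie g x -> F (pr1 (dLeib x)) = 0.
Proof.
move=> F0 x; apply: (@pr1_d_bracket k g T (@letter k g) (@tensor_ind_rcons k g)
  sgn (@aug k g) (@pr1 k g) (tscale1 _ _) (tscaleM _) (@augM k g) (@aug_letter k g)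
  (@pr1M k g) (@pr1_letter k g) (@act k g) act_is_deriv (@dLeib k g) (dLeib1 g)
  (@dLeib_mul_letter k g) (tensor_deg g) (gLie g) gLie_ind
  (@tscale_deg k g _) (@pr1_deg k g) Q F pr1_1 F0).
Qed.

Section Exactness.
Variables (W : lmodType k) (gen : {linear W -> g}).
Hypothesis g_ind : forall A : g -> Prop,
  A 0 -> (forall a x y, A x -> A y -> A (a *: x + y)) ->
  (forall v, A (gen v)) -> (forall x y, A x -> A y -> A (x ** y)) ->
  forall x, A x.
Hypothesis g_univ : forall (A : leibnizType k) (f : {linear W -> A}),
  exists phi : {linear g -> A},
  [/\ forall x y, phi (x ** y) = phi x ** phi y,
      forall v, phi (gen v) = f v
    & forall psi : {linear g -> A},
        (forall x y, psi (x ** y) = psi x ** psi y) ->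
        (forall v, psi (gen v) = f v) -> psi =1 phi].
Hypothesis char0 : forall m, (0 < m)%N -> m%:R != 0 :> k.

Lemma gLie_exact n x : n != 1 -> gLie_deg g n x -> dLeib x = 0 ->
  exists2 y, gLie_deg g (n + 1) y & x = dLeib y.
Proof.
pose l : {linear g -> T} := @letter k g.
have T_ind := @tensor_ind_rcons k g.
have actD := act_is_deriv.
have [N [theta [eta [[Ngen NM] [thgen thM] [etagen etaM]]]]] :=
  homotopy_operators_exist (act_lin T_ind actD) (act_act T_ind actD)
    (letter_bracket_linl l) (letter_bracket_linr l) (act_letter_bracket actD)
    g_ind g_univ.
have eta2 u : tensor_deg g 2 (eta u).
  apply: (eta_in g_ind (act := @act k g)
    (br := letter_bracket l) _ _ etagen etaM).
  - by move=> y z; apply: act_deg.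
  - exact: letter_bracket_deg.
(* The odd derivation extending [eta] on letters; the weight below extends as an ordinary one. *)
pose h : {linear T -> T} := tder (-1) (linearP eta).
pose Nt : {linear T -> T} := lder (linearP N).
move=> n1 [Lx nx] dx.
have hl u : h (letter u) = eta u by exact: tder_letter.
apply: (@L_exact k g T l T_ind (tscale (-1)) (@aug k g) (@pr1 k g) (tscale1 _ _)
  (tscaleM _) sgn_letter (@augM k g) (@aug_letter k g) (@pr1M k g)
  (@pr1_letter k g) (@act k g) actD (@dLeib k g) (dLeib1 g) (@dLeib_mul_letter k g)
  h Nt theta N _ _ _ _ W gen g_ind Ngen NM thgen thM _
  (tensor_deg g) (gLie g) gLie_ind (@gLie_letter k g) (@gLie_bracket k g)
  (@tensor_deg_letter k g) (@tscale_deg k g _) (@pr1_deg k g) act_deg _ _ n x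
  char0 n1 Lx nx dx).
- exact: tderM.
- by split; [exact: lderM | exact: lder_letter].
- move=> u; rewrite hl; apply: etrans (@tscale_deg k g (-1) 2 _ (eta2 u)) _.
  by rewrite expr2 mulrNN mulr1 scale1r.
- by move=> u y; rewrite !hl etaM; congr (_ - _); exact: addrC.
- by move=> v; rewrite hl etagen.
- by move=> m y my; apply: lder_deg.
- by move=> m y my; apply: tder_deg.
Qed.
End Exactness.

End PirashviliComplex.

Section FreeLeibnizPirashvili.
Variables (k : fieldType) (V : lmodType k).
Hypothesis char_k0 : [pchar k] =i pred0.
Local Notation g := (freeLeib V).
Local Notation T := (tensor g).

Let char0 m : (0 < m)%N -> m%:R != 0 :> k.
Proof. by move=> m0; rewrite (pcharf0P k).1 -?lt0n. Qed.

End FreeLeibnizPirashvili.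

(** * Recognising the homology of a complex in one degree *)

Section HomologyCriteria.
Variables (k : fieldType) (M : lmodType k) (d : {linear M -> M}).
Variables (C : int -> subspace M) (n : int).

Lemma homology_eq0 :
  (forall x, C n x -> d x = 0 -> exists2 y, C (n + 1) y & x = d y) ->
  forall h : homology d C n, h = 0.
Proof.
move=> ex h; have [z ->] := lpi_surj h.
rewrite -(lpi0 (boundaries d C n)); apply/lpi_eq; rewrite subr0.
by have /subspace_predP[Cz dz] := valP z; apply: ex.
Qed.

(** [F] is restricted to cycles and descends to the quotient; the inverse picks preimages by
    choice. *)
Lemma homology_iso (Q : lmodType k) (F : {linear M -> Q}) :
  (forall y, C (n + 1) y -> F (d y) = 0) ->
  (forall x, C n x -> d x = 0 -> F x = 0 -> exists2 y, C (n + 1) y & x = d y) ->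
  (forall q, exists x, [/\ C n x, d x = 0 & F x = q]) ->
  lmod_isomorphic (homology d C n) Q.
Proof.
move=> F0 Fker Fsurj.
pose e : {linear subspace_type (cycles d C n) -> Q} := F \o val.
have e0 z : boundaries d C n z -> e z = 0 by case=> y Cy /= ->; apply: F0.
pose f : {linear homology d C n -> Q} := lquot_lift e0.
have fE z : f (lpi _ z) = F (val z) by exact: lquot_liftE.
exists f; have f_surj q : exists h, f h == q.
  have [x [Cx dx <-]] := Fsurj q.
  have cx : x \in subspace_pred (cycles d C n) by apply/subspace_predP.
  by exists (lpi _ (Sub x cx)); rewrite fE.
have f_inj : injective f.
  apply: raddf_inj => h fh0; have [z hz] := lpi_surj h.
  have Fz : F (val z) = 0 by rewrite -fE -hz.
  rewrite hz {h hz fh0}.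
  rewrite -(lpi0 (boundaries d C n)); apply/lpi_eq; rewrite subr0.
  by have /subspace_predP[Cz dz] := valP z; apply: Fker.
exists (fun q => xchoose (f_surj q)) => [h|q]; last exact/eqP/(xchooseP (f_surj q)).
by apply: f_inj; apply/eqP/(xchooseP (f_surj (f h))).
Qed.

End HomologyCriteria.

(** * The first homology group *)

Section FirstHomology.
Variables (k : fieldType) (g : leibnizType k).

Lemma dLeib_letter (x : g) : dLeib (letter x) = 0.
Proof.
by rewrite -[letter x]mul1r dLeib_mul_letter dLeib1 mul0r tscale1 /act lder1 addr0.
Qed.

Lemma dLeib_letter2 (x y : g) : dLeib (letter x * letter y) = - letter (x ** y).
Proof.
rewrite dLeib_mul_letter dLeib_letter mul0r add0r tscale_letter actZ scaleN1r.
by rewrite /act lder_letter.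
Qed.

Lemma dLeib_letter_bracket (x y : g) :
  dLeib (letter_bracket (@letter k g) x y) = - letter (x ** y + y ** x).
Proof.
rewrite (linearD (@letter k g)) opprD -!dLeib_letter2.
exact: (linearD (@dLeib k g)).
Qed.

Lemma letter_bracket_gLie (x y : g) :
  gLie_deg g 2 (letter_bracket (@letter k g) x y).
Proof.
split; last exact: letter_bracket_deg.
have := @gLie_bracket k g 1 1 _ _ (tensor_deg_letter x) (tensor_deg_letter y)
  (gLie_letter x) (gLie_letter y).
by rewrite muln1 expr1 scaleN1r opprK.
Qed.

Lemma leib_ker_boundary (u : g) : leib_ker g u ->
  exists2 y, gLie_deg g 2 y & letter u = dLeib y.
Proof.
elim=> [|a v w [y [z ->]] _ [t Ct dt]].
  by exists 0; [exact: (subspace0 (gLie_deg g 2)) | rewrite !linear0].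
(* The sign undoes the one in [dLeib_letter_bracket]. *)
exists ((- a) *: letter_bracket (@letter k g) y z + t).
  exact: (subspace_lin (- a) (letter_bracket_gLie y z) Ct).
have dP b x y' : dLeib (b *: x + y') = b *: dLeib x + dLeib y' :> tensor g.
  exact: linearP.
rewrite dP -dt dLeib_letter_bracket scalerN scaleNr opprK; exact: linearP.
Qed.

Variables (Q : lmodType k) (F : {linear g -> Q}).

(** In degree 1 every element is a letter and every letter is a cycle, so only boundaries matter:
    [F] kills them by [pr1_dLeib_gLie], and its kernel consists of them by [leib_ker_boundary]. *)
Lemma pirashvili_homology1 :
  (forall u v, F (u ** v) + F (v ** u) = 0) ->
  (forall u, F u = 0 -> leib_ker g u) -> (forall q, exists u, F u = q) ->
  lmod_isomorphic (pirashvili_homology g 1) Q.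
Proof.
move=> Fsym Fker Fsurj.
apply: (@homology_iso k _ (@dLeib k g) (gLie_deg g) 1 Q (F \o @pr1 k g)) => /=.
- by move=> y [Ly _]; apply: pr1_dLeib_gLie.
- by move=> x [Lx x1] _ /Fker/leib_ker_boundary; rewrite letter_pr1.
move=> q; have [u <-] := Fsurj q; exists (letter u); split.
- by split; [exact: gLie_letter | exact: tensor_deg_letter].
- exact: dLeib_letter.
- by rewrite pr1_letter.
Qed.

End FirstHomology.

Theorem theorem2 (k : fieldType) (char_k0 : [pchar k] =i pred0)
  (V : lmodType k) :
  lmod_isomorphic (pirashvili_homology (freeLeib V) 1) (freeLie V) /\
  (forall n : int, n != 1 ->
     forall h : pirashvili_homology (freeLeib V) n, h = 0).
Proof.
have char0 m : (0 < m)%N -> m%:R != 0 :> k.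
  by move=> m0; rewrite (pcharf0P k).1 -?lt0n.
split.
  apply: (@pirashvili_homology1 k (freeLeib V) (freeLie V) (@lie_of_leib k V)).
  - exact: lie_of_leib_antisym.
  - by move=> u; apply: lie_of_leib_ker; exact: char0.
  - exact: lie_of_leib_surj.
move=> n n1; apply: homology_eq0 => x.
exact: (gLie_exact (@freeLeib_ind k V) (@freeLeib_univ k V) char0 n1).
Qed.
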